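(* Let $\mathbb{K}=\mathbb{C}$ or $\mathbb{K}=\mathbb{R}$, let $(\Gamma,+)$ be an abelian group with a bilinear map $\langle\,,\,\rangle:\Gamma\times\Gamma\to\mathbb{Z}_2$, and let $\mathcal{A}$ be a finite-dimensional simple associative $\Gamma$-commutative algebra over $\mathbb{K}$. Then $\mathcal{A}$ is isomorphic to a Clifford algebra.
   Context: $\Gamma$-commutative algebra: an algebra $\mathcal{A}$ that is $\Gamma$-graded, $\mathcal{A}=\bigoplus_{\gamma\in\Gamma}\mathcal{A}_\gamma$ with $\mathcal{A}_\gamma\cdot\mathcal{A}_{\gamma'}\subset\mathcal{A}_{\gamma+\gamma'}$, and such that $ab=(-1)^{\langle\bar a,\bar b\rangle}\,ba$ for all homogeneous $a,b\in\mathcal{A}$, where $\bar a,\bar b\in\Gamma$ denote the degrees of $a,b$. Bilinear means additive in each argument. Simple: an algebra is called simple if it has no proper two-sided ideal, that is, no two-sided ideal other than $0$ and $\mathcal{A}$ (ideals are not required to be graded). Clifford algebras: for integers $p,q\ge 0$ and $n=p+q$, the real Clifford algebra $\mathrm{Cl}_{p,q}$ is the associative real algebra with unit $\varepsilon$ and generators $\alpha_1,\dots,\alpha_n$ subject to $\alpha_i\alpha_j=-\alpha_j\alpha_i$ for $i\ne j$, $\alpha_i^2=\varepsilon$ for $1\le i\le p$, and $\alpha_i^2=-\varepsilon$ for $p<i\le n$. The complex Clifford algebra is $\mathrm{Cl}_n=\mathrm{Cl}_{p,q}\otimes_{\mathbb{R}}\mathbb{C}$ ($n=p+q$). When $\mathbb{K}=\mathbb{C}$,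 ''Clifford algebra'' means some $\mathrm{Cl}_n$; when $\mathbb{K}=\mathbb{R}$, it means some $\mathrm{Cl}_{p,q}$ or some $\mathrm{Cl}_n$ viewed as an algebra over $\mathbb{R}$. The case $n=0$ (the ground field) is included.
   Formalization: ''Simple'' is taken to include that the product is not identically zero; this excludes only the zero algebra and the one-dimensional algebra with zero product, which have no ideals other than 0 and A but are not Clifford algebras. *)

(* Defs.v *)
From HB Require Import structures.
From mathcomp Require Import all_boot all_order all_algebra.
From mathcomp Require Import ring_quotient sesquilinear.
From mathcomp Require Import boolp reals complex.
From mathcomp Require Import monalg.

Set Implicit Arguments.
Unset Strict Implicit.
Unset Printing Implicit Defensive.

Import GRing.Theory.
Local Open Scope ring_scope.
Local Open Scope quotient_scope.

(* Algebras are not assumed unital: a finite-dimensional K-algebra is a        *)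
(* [vectType K] together with a bilinear product.                              *)
Section GradedAlgebra.
Variables (K : fieldType) (Gamma : zmodType) (A : vectType K).
Variable mul : {bilinear A -> A -> A}.
Implicit Type deg : Gamma -> {vspace A}.

(* Gamma may be infinite, so the direct sum is spelled out with finite         *)
(* families of pairwise distinct degrees.                                      *)
Definition direct_sum deg : Prop :=
  (forall a : A, exists s : seq Gamma, a \in (\sum_(g <- s) deg g)%VS) /\
  (forall (s : seq Gamma) (x : Gamma -> A),
     uniq s -> (forall g, x g \in deg g) ->
     \sum_(g <- s) x g = 0 -> forall g, g \in s -> x g = 0).

Definition graded deg : Prop :=
  direct_sum deg /\
  (forall g h a b, a \in deg g -> b \in deg h -> mul a b \in deg (g + h)).

(* The exponent is the representative in {0, 1} of an element of 'Z_2.         *)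
Definition graded_commutative (pairing : Gamma -> Gamma -> 'Z_2) deg : Prop :=
  graded deg /\
  (forall g h a b, a \in deg g -> b \in deg h ->
     mul a b = (-1) ^+ pairing g h *: mul b a).

Definition two_sided_ideal (I : {vspace A}) : Prop :=
  forall a x, x \in I -> mul a x \in I /\ mul x a \in I.

(* The first clause is the usual convention that the product of a simple       *)
(* algebra is not identically zero.  It excludes the zero algebra and the line *)
(* with zero product, in which every ideal is trivially 0 or everything.       *)
Definition is_simple : Prop :=
  (exists a b, mul a b <> 0) /\
  (forall I : {vspace A}, two_sided_ideal I -> I = 0%VS \/ I = fullv).

End GradedAlgebra.

Definition biadditive (Gamma : zmodType) (pairing : Gamma -> Gamma -> 'Z_2) :=
  (forall x y z, pairing (x + y) z = pairing x z + pairing y z) /\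
  (forall x y z, pairing x (y + z) = pairing x y + pairing x z).

Definition generated_ideal (F : nzRingType) (S : F -> Prop) (x : F) : Prop :=
  forall J : F -> Prop,
    J 0 -> (forall u v, J u -> J v -> J (u + v)) ->
    (forall a u, J u -> J (a * u) /\ J (u * a)) ->
    (forall u, S u -> J u) -> J x.

Lemma mulrB_split (F : nzRingType) (x x' y y' : F) :
  x * y - x' * y' = (x - x') * y + x' * (y - y').
Proof. by rewrite mulrBl mulrBr addrA subrK. Qed.

(* The Clifford algebra on p + q generators over R is the quotient of the free *)
(* associative algebra by the two-sided ideal generated by the relations.      *)
Section Clifford.
Variables (R : comNzRingType) (p q : nat).

Definition free_alg := {malg R[{fmonom 'I_(p + q)}]}.

Definition free_gen (i : 'I_(p + q)) : free_alg := mkmalgU (fmu i) 1.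

(* Generators are numbered from 0, so the first p ones have square 1.          *)
Inductive clifford_relation : free_alg -> Prop :=
| clifford_anticommute (i j : 'I_(p + q)) : i != j ->
    clifford_relation (free_gen i * free_gen j - - (free_gen j * free_gen i))
| clifford_square_pos (i : 'I_(p + q)) : (i < p)%N ->
    clifford_relation (free_gen i ^+ 2 - 1)
| clifford_square_neg (i : 'I_(p + q)) : (p <= i)%N ->
    clifford_relation (free_gen i ^+ 2 - - 1).

Definition clifford_ideal : {pred free_alg} :=
  fun x => `[< generated_ideal clifford_relation x >].

Lemma clifford_ideal0 : clifford_ideal 0.
Proof. by rewrite /clifford_ideal; apply/asboolP => J J0 _ _ _; exact: J0. Qed.

Lemma clifford_idealD x y :
  clifford_ideal x -> clifford_ideal y -> clifford_ideal (x + y).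
Proof.
move=> /asboolP Ix /asboolP Iy; apply/asboolP => J J0 JD JM JS.
by apply: (JD); [exact: (Ix J J0 JD JM JS) | exact: (Iy J J0 JD JM JS)].
Qed.

Lemma clifford_idealMl a x : clifford_ideal x -> clifford_ideal (a * x).
Proof.
move=> /asboolP Ix; apply/asboolP => J J0 JD JM JS.
by have [] := JM a x (Ix J J0 JD JM JS).
Qed.

Lemma clifford_idealMr a x : clifford_ideal x -> clifford_ideal (x * a).
Proof.
move=> /asboolP Ix; apply/asboolP => J J0 JD JM JS.
by have [] := JM a x (Ix J J0 JD JM JS).
Qed.

Lemma clifford_ideal_zmod_closed : zmod_closed clifford_ideal.
Proof.
split; first exact: clifford_ideal0.
move=> x y Ix Iy; apply: clifford_idealD => //.
by rewrite -mulN1r; apply: clifford_idealMl.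
Qed.

HB.instance Definition _ :=
  GRing.isZmodClosed.Build free_alg clifford_ideal clifford_ideal_zmod_closed.

(* Matrices satisfying the relations, used only to see that 1 is not in the    *)
(* ideal.                                                                      *)
Lemma clifford_matrices n (s : nat -> R) :
  exists m (E : nat -> 'M[R]_m.+1),
    (forall i j, (i < n)%N -> (j < n)%N -> i != j ->
       E i *m E j = - (E j *m E i)) /\
    (forall i, (i < n)%N -> E i *m E i = (s i)%:M).
Proof.
elim: n => [|n [m [E [EC E2]]]]; first by exists 0%N, (fun=> 0).
pose M i : 'M[R]_(m.+1 + m.+1) :=
  if (i < n)%N then block_mx (E i) 0 0 (- E i)
  else block_mx 0 (s n)%:M 1%:M 0.
have MC i j : (i < n.+1)%N -> (j < n.+1)%N -> i != j ->
    M i *m M j = - (M j *m M i).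
  rewrite /M !ltnS leq_eqVlt => /predU1P[->|lt_in];
    rewrite leq_eqVlt => /predU1P[->|lt_jn].
  + by rewrite eqxx.
  + rewrite ltnn lt_jn => _; rewrite !mulmx_block opp_block_mx.
    rewrite !(mul0mx, mulmx0, mul1mx, mulmx1, add0r, addr0, oppr0).
    by rewrite mulmxN mul_scalar_mx mul_mx_scalar opprK.
  + rewrite ltnn lt_in => _; rewrite !mulmx_block opp_block_mx.
    rewrite !(mul0mx, mulmx0, mul1mx, mulmx1, add0r, addr0, oppr0).
    by rewrite mulmxN mul_scalar_mx mul_mx_scalar opprK.
  + rewrite lt_in lt_jn => neq_ij; rewrite !mulmx_block opp_block_mx.
    rewrite !(mul0mx, mulmx0, add0r, addr0, oppr0).
    by rewrite !mulNmx !mulmxN !opprK EC.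
have M2 i : (i < n.+1)%N -> M i *m M i = (s i)%:M.
  rewrite /M ltnS leq_eqVlt => /predU1P[->|lt_in].
    rewrite ltnn mulmx_block.
    rewrite !(mul0mx, mulmx0, mul1mx, mulmx1, add0r, addr0).
    by rewrite -scalar_mx_block.
  rewrite lt_in mulmx_block !(mul0mx, mulmx0, add0r, addr0).
  by rewrite mulNmx mulmxN opprK E2 // -scalar_mx_block.
by exists (m + m.+1)%N, M.
Qed.

Lemma clifford_ideal1 : ~~ clifford_ideal 1.
Proof.
apply/negP => /asboolP I1.
have [m [E [EC E2]]] :=
  clifford_matrices (p + q) (fun i => if (i < p)%N then 1 else -1).
pose h (w : {fmonom 'I_(p + q)}) : 'M[R]_m.+1 := \prod_(i <- (w : seq _)) E i.
have hM : mmorphism h.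
  by split=> [x y|]; rewrite /h ?fmM ?big_cat // fm1 big_nil.
pose hb := HB.pack_for {mmorphism {fmonom 'I_(p + q)} -> 'M[R]_m.+1} h
  (isMultiplicative.Build _ _ h hM).
pose f : {rmorphism R -> 'M[R]_m.+1} := @scalar_mx R m.+1.
have phiM : multiplicative (mmap f hb : free_alg -> _).
  by apply: commr_mmap_is_multiplicative => g u v; rewrite /GRing.comm -!mulmxE scalar_mxC.
have phiX i : mmap f hb (free_gen i) = E i.
  by rewrite mmapU /= mul1r /h fmU big_seq1.
have phiXX i j : mmap f hb (free_gen i * free_gen j) = E i *m E j.
  by rewrite phiM.1 !phiX.
have phiB : {morph mmap f hb : x y / x - y} by exact: mmapB.
have phiN : {morph mmap f hb : x / - x} by exact: mmapN.
suff : mmap f hb (1 : free_alg) = 0 by rewrite phiM.2 => /eqP; rewrite oner_eq0.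
apply: (I1 (fun x => mmap f hb x = 0)).
- exact: mmap0.
- by move=> u v u0 v0; rewrite mmapD u0 v0 addr0.
- by move=> a u u0; rewrite !phiM.1 u0 mulr0 mul0r.
- move=> _ [i j neq_ij|i lt_ip|i le_pi].
  + by rewrite phiB phiN !phiXX (EC i j (ltn_ord i) (ltn_ord j) neq_ij) subrr.
  + by rewrite phiB phiM.2 phiXX (E2 i (ltn_ord i)) lt_ip subrr.
  + rewrite phiB phiN phiM.2 phiXX (E2 i (ltn_ord i)) ltnNge le_pi /=.
    by rewrite (raddfN f) opprK addNr.
Qed.

Definition clifford := Quotient.quot clifford_ideal.

HB.instance Definition _ := GRing.Zmodule.on clifford.

Local Notation pi := (\pi_clifford : free_alg -> clifford).

Definition clifford_one : clifford := pi 1.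
Definition clifford_mul (x y : clifford) : clifford := pi (repr x * repr y).
Definition clifford_scale (c : R) (x : clifford) : clifford :=
  pi (c *: repr x).

Lemma clifford_piP x y : reflect (pi x = pi y) (clifford_ideal (x - y)).
Proof.
rewrite -[clifford_ideal _]/(_ \in clifford_ideal) Quotient.idealrBE.
exact: eqP.
Qed.

Lemma clifford_piD x y : pi (x + y) = pi x + pi y.
Proof. by rewrite !piE. Qed.

Lemma clifford_piM x y : pi (x * y) = clifford_mul (pi x) (pi y).
Proof.
apply/clifford_piP; rewrite (mulrB_split _ (repr (pi x))).
have Ix : clifford_ideal (x - repr (pi x)) by apply/clifford_piP; rewrite reprK.
have Iy : clifford_ideal (y - repr (pi y)) by apply/clifford_piP; rewrite reprK.
by apply: clifford_idealD; [apply: clifford_idealMr | apply: clifford_idealMl].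
Qed.

Lemma clifford_piZ c x : pi (c *: x) = clifford_scale c (pi x).
Proof.
apply/clifford_piP; rewrite -scalerBr -mul_malgC; apply: clifford_idealMl.
by apply/clifford_piP; rewrite reprK.
Qed.

Lemma clifford_mulA : associative clifford_mul.
Proof.
elim/quotW=> x; elim/quotW=> y; elim/quotW=> z.
by rewrite -(clifford_piM y z) -(clifford_piM x y) -(clifford_piM x (y * z))
  -(clifford_piM (x * y) z) mulrA.
Qed.

Lemma clifford_mul1 : left_id clifford_one clifford_mul.
Proof.
by elim/quotW=> x; rewrite -(clifford_piM 1 x) mul1r.
Qed.

Lemma clifford_mulr1 : right_id clifford_one clifford_mul.
Proof.
by elim/quotW=> x; rewrite -(clifford_piM x 1) mulr1.
Qed.

Lemma clifford_mulDl : left_distributive clifford_mul +%R.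
Proof.
elim/quotW=> x; elim/quotW=> y; elim/quotW=> z.
by rewrite -(clifford_piD x y) -(clifford_piM x z) -(clifford_piM y z)
  -(clifford_piM (x + y) z) -(clifford_piD (x * z) (y * z)) mulrDl.
Qed.

Lemma clifford_mulDr : right_distributive clifford_mul +%R.
Proof.
elim/quotW=> x; elim/quotW=> y; elim/quotW=> z.
by rewrite -(clifford_piD y z) -(clifford_piM x y) -(clifford_piM x z)
  -(clifford_piM x (y + z)) -(clifford_piD (x * y) (x * z)) mulrDr.
Qed.

Lemma clifford_one_neq0 : clifford_one != 0.
Proof.
apply/eqP; rewrite [0 in RHS](_ : _ = pi 0); last by rewrite piE.
by move=> /clifford_piP; rewrite subr0; apply/negP; exact: clifford_ideal1.
Qed.

HB.instance Definition _ := GRing.Zmodule_isNzRing.Build clifford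
  clifford_mulA clifford_mul1 clifford_mulr1 clifford_mulDl clifford_mulDr
  clifford_one_neq0.

Lemma clifford_scaleA a b x :
  clifford_scale a (clifford_scale b x) = clifford_scale (a * b) x.
Proof.
elim/quotW: x => x.
by rewrite -(clifford_piZ b x) -(clifford_piZ a (b *: x))
  -(clifford_piZ (a * b) x) scalerA.
Qed.

Lemma clifford_scale1 : left_id 1 clifford_scale.
Proof.
by elim/quotW=> x; rewrite -(clifford_piZ 1 x) scale1r.
Qed.

Lemma clifford_scaleDr : right_distributive clifford_scale +%R.
Proof.
move=> a; elim/quotW=> x; elim/quotW=> y.
by rewrite -(clifford_piD x y) -(clifford_piZ a x) -(clifford_piZ a y)
  -(clifford_piZ a (x + y)) -(clifford_piD (a *: x) (a *: y)) scalerDr.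
Qed.

Lemma clifford_scaleDl x :
  {morph clifford_scale^~ x : a b / a + b >-> a + b}.
Proof.
move=> a b; elim/quotW: x => x.
by rewrite -(clifford_piZ a x) -(clifford_piZ b x) -(clifford_piZ (a + b) x)
  -(clifford_piD (a *: x) (b *: x)) scalerDl.
Qed.

HB.instance Definition _ := GRing.Zmodule_isLmodule.Build R clifford
  clifford_scaleA clifford_scale1 clifford_scaleDr clifford_scaleDl.

Lemma clifford_scaleAl (a : R) (x y : clifford) : a *: (x * y) = (a *: x) * y.
Proof.
elim/quotW: x => x; elim/quotW: y => y.
rewrite -[LHS]/(clifford_scale a (clifford_mul (pi x) (pi y))).
rewrite -[RHS]/(clifford_mul (clifford_scale a (pi x)) (pi y)).
by rewrite -(clifford_piM x y) -(clifford_piZ a x) -(clifford_piZ a (x * y))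
  -(clifford_piM (a *: x) y) scalerAl.
Qed.

HB.instance Definition _ := GRing.Lmodule_isLalgebra.Build R clifford
  clifford_scaleAl.

Lemma free_alg_scaleAr (a : R) (x y : free_alg) : a *: (x * y) = x * (a *: y).
Proof.
have xa : x * mkmalgU monalg.one a = a *: x.
  rewrite malgM_def fgmulgU malgZ_def; apply: eq_bigr => k _.
  by rewrite monalg.mulm1 mulrC.
by rewrite -(mul_malgC a y) mulrA xa scalerAl.
Qed.

Lemma clifford_scaleAr (a : R) (x y : clifford) : a *: (x * y) = x * (a *: y).
Proof.
elim/quotW: x => x; elim/quotW: y => y.
rewrite -[LHS]/(clifford_scale a (clifford_mul (pi x) (pi y))).
rewrite -[RHS]/(clifford_mul (pi x) (clifford_scale a (pi y))).
by rewrite -(clifford_piM x y) -(clifford_piZ a y) -(clifford_piZ a (x * y))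
  -(clifford_piM x (a *: y)) free_alg_scaleAr.
Qed.

HB.instance Definition _ := GRing.Lalgebra_isAlgebra.Build R clifford
  clifford_scaleAr.

End Clifford.

(* B (x)_R R[i] for an R-algebra B: as R[i] is free over R with basis 1, i,    *)
(* every element is uniquely x (x) 1 + y (x) i, encoded here as the pair       *)
(* (x, y).                                                                     *)
Section Complexification.
Variables (R : rcfType) (B : algType R).

Definition complexification : Type := (B * B)%type.

HB.instance Definition _ := GRing.Zmodule.copy complexification (B * B)%type.

Implicit Types u v w : complexification.

Definition cplx_one : complexification := (1, 0).
Definition cplx_mul u v : complexification :=
  (u.1 * v.1 - u.2 * v.2, u.1 * v.2 + u.2 * v.1).
Definition cplx_scale (c : R[i]) u : complexification :=
  (complex.Re c *: u.1 - complex.Im c *: u.2,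
   complex.Re c *: u.2 + complex.Im c *: u.1).

Lemma cplx_mulA : associative cplx_mul.
Proof.
move=> [a b] [c d] [e f]; rewrite /cplx_mul /=.
rewrite !(mulrDl, mulrDr, mulrBl, mulrBr, mulrN, mulNr, opprD, opprK, mulrA).
by congr pair; rewrite ?opprD !addrA; [rewrite [RHS](ACl (1*3*4*2))|
  rewrite [RHS](ACl (1*3*4*2))].
Qed.

Lemma cplx_mul1 : left_id cplx_one cplx_mul.
Proof.
by move=> [a b]; rewrite /cplx_mul /= !mul1r !mul0r subr0 addr0.
Qed.

Lemma cplx_mulr1 : right_id cplx_one cplx_mul.
Proof.
by move=> [a b]; rewrite /cplx_mul /= !mulr1 !mulr0 subr0 add0r.
Qed.

Lemma cplx_mulDl : left_distributive cplx_mul +%R.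
Proof.
move=> [a b] [c d] [e f]; congr pair; rewrite /= !mulrDl.
  by rewrite opprD addrACA.
by rewrite addrACA.
Qed.

Lemma cplx_mulDr : right_distributive cplx_mul +%R.
Proof.
move=> [a b] [c d] [e f]; congr pair; rewrite /= !mulrDr.
  by rewrite opprD addrACA.
by rewrite addrACA.
Qed.

Lemma cplx_one_neq0 : cplx_one != 0.
Proof. by apply/eqP => -[] /eqP; rewrite oner_eq0. Qed.

HB.instance Definition _ := GRing.Zmodule_isNzRing.Build complexification
  cplx_mulA cplx_mul1 cplx_mulr1 cplx_mulDl cplx_mulDr cplx_one_neq0.

Lemma cplx_scaleA c d u : cplx_scale c (cplx_scale d u) = cplx_scale (c * d) u.
Proof.
case: c d u => [a b] [c d] [x y]; rewrite /cplx_scale /=.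
rewrite !(scalerBr, scalerDr, scalerBl, scalerDl, scalerA, opprD).
by congr pair; rewrite !addrA; [rewrite [LHS](ACl (1*4*2*3)) |
  rewrite [LHS](ACl (1*4*2*3))].
Qed.

Lemma cplx_scale1 : left_id 1 cplx_scale.
Proof.
by move=> [x y]; rewrite /cplx_scale /= !scale1r !scale0r subr0 addr0.
Qed.

Lemma cplx_scaleDr : right_distributive cplx_scale +%R.
Proof.
move=> c [x y] [z t]; congr pair; rewrite /= !scalerDr ?opprD addrACA //.
Qed.

Lemma cplx_scaleDl u : {morph cplx_scale^~ u : c d / c + d >-> c + d}.
Proof.
case: u => x y [a b] [c d]; congr pair; rewrite /= !scalerDl ?opprD addrACA //.
Qed.

HB.instance Definition _ := GRing.Zmodule_isLmodule.Build R[i] complexification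
  cplx_scaleA cplx_scale1 cplx_scaleDr cplx_scaleDl.

Lemma cplx_scaleAl (c : R[i]) u v : c *: (u * v) = (c *: u) * v.
Proof.
case: c u v => [a b] [x y] [z t]; congr pair; rewrite /= !(mulrBl, mulrDl).
  rewrite -!scalerAl !(scalerBr, scalerDr) !opprD !addrA.
  by rewrite [LHS](ACl (1*4*2*3)).
rewrite -!scalerAl !(scalerBr, scalerDr) !addrA.
by rewrite [LHS](ACl (1*4*2*3)).
Qed.

Lemma cplx_scaleAr (c : R[i]) u v : c *: (u * v) = u * (c *: v).
Proof.
case: c u v => [a b] [x y] [z t]; congr pair; rewrite /= !(mulrBr, mulrDr).
  rewrite -!scalerAr !(scalerBr, scalerDr) !opprD !addrA.
  by rewrite [LHS](ACl (1*3*2*4)).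
rewrite -!scalerAr !(scalerBr, scalerDr) !addrA.
by rewrite [LHS](ACl (1*3*2*4)).
Qed.

HB.instance Definition _ := GRing.Lmodule_isLalgebra.Build R[i] complexification
  cplx_scaleAl.
HB.instance Definition _ := GRing.Lalgebra_isAlgebra.Build R[i] complexification
  cplx_scaleAr.

End Complexification.

(* The L-algebra B is viewed over K by restriction of scalars along s.  The    *)
(* two algebras are isomorphic as non-unital ones; if mul has a unit, then f   *)
(* being bijective and multiplicative sends it to 1.                           *)
Definition alg_isomorphic (K L : fieldType) (s : {rmorphism K -> L})
    (A : vectType K) (mul : {bilinear A -> A -> A}) (B : algType L) : Prop :=
  exists f : {linear A -> B | s \; *:%R},
    bijective f /\ {morph f : x y / mul x y >-> x * y}.

(* Depends only on p + q up to isomorphism.                                    *)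
Definition complex_clifford (R : rcfType) (p q : nat) : algType R[i] :=
  complexification (clifford R p q).

(* Main.v *)
From HB Require Import structures.
Require Import Defs.
From mathcomp Require Import all_boot all_order all_algebra falgebra.
From mathcomp Require Import sesquilinear boolp reals complex monalg.

Set Implicit Arguments.
Unset Strict Implicit.
Unset Printing Implicit Defensive.

Import GRing.Theory Num.Theory.
Local Open Scope ring_scope.

(** In a simple graded commutative algebra A, a nonzero homogeneous element a
    commutes or anticommutes with each homogeneous element, so a A is a
    two-sided ideal and a A = A ([homogeneous_surjective]). By finite dimension
    a can be cancelled. Hence A has a unit ([simple_unit]), and the set H of
    nonzero homogeneous elements is stable under products, spans A, and consists
    of elements that pairwise commute or anticommute
    ([homogeneous_sign_commutative]).

    A central element of A is annihilated by a polynomial and is not a zero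
    divisor unless it is zero. So the centre is the ground field K, or else
    K = R and the centre is R + R j with j ^ 2 = -1
    ([central_scalars_or_complex]). In the latter case A is an algebra over C
    with centre C, spanned by the complex multiples of H. It remains to treat
    the case where the centre is K, over both fields.

    The square of an element of H is then a nonzero scalar, and can be
    normalised to 1 or -1. Consider a family t of an even number of normalised,
    pairwise anticommuting elements of H. If two elements of H that do not
    commute exist, one of which commutes with t, then t can be enlarged by two
    elements ([clifford_system_extend]). This process stops, as anticommuting
    elements are linearly independent. At the end each h in H, multiplied by a
    suitable product of elements of t, commutes with t ([word_adjust]), hence
    with H, hence is a scalar, so the products of elements of t span A
    ([maximal_system_spans]).

    Finally, products of an even number of anticommuting generators satisfy no
    linear relation but those imposed by the signs of the squares
    ([lincomb_relation]). Therefore an algebra spanned by such products is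
    determined up to isomorphism by the signs ([clifford_system_iso]), and A is
    the Clifford algebra with the same signs, real or complex. *)

(** * Words in anticommuting generators *)

(** The sign of each square is recorded in the exponent [s i]. The family is
    indexed by a list of an arbitrary type, so that it can be a list of
    elements of an algebra as well as the standard generators of a Clifford
    algebra. *)
Definition clifford_system (D : nzRingType) (I : eqType) (s : I -> bool)
    (e : I -> D) (t : seq I) : Prop :=
  [/\ uniq t, {in t, forall i, e i ^+ 2 = (-1) ^+ s i}
    & {in t &, forall i j, i != j -> e i * e j = - (e j * e i)}].

Definition word (D : nzRingType) (I : eqType) (e : I -> D) (w : seq I) : D :=
  \prod_(i <- w) e i.

Section Words.
Variables (D : nzRingType) (I : eqType) (s : I -> bool) (e : I -> D).
Variable t : seq I.
Hypothesis sys : clifford_system s e t.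

Lemma word_cat w1 w2 : word e (w1 ++ w2) = word e w1 * word e w2.
Proof. by rewrite /word big_cat. Qed.

Lemma word_cons i w : word e (i :: w) = e i * word e w.
Proof. by rewrite /word big_cons. Qed.

Lemma word_swap j w : j \in t -> {subset w <= t} ->
  e j * word e w = (-1) ^+ count (predC1 j) w * (word e w * e j).
Proof.
case: sys => _ _ eC tj; elim: w => [|i w IHw] wt.
  by rewrite /word big_nil expr0 mulr1 !mul1r.
have ti : i \in t by apply: wt; rewrite mem_head.
have {}IHw : e j * word e w = (-1) ^+ count (predC1 j) w * (word e w * e j).
  by apply: IHw => k kw; apply: wt; rewrite inE kw orbT.
rewrite word_cons /=; have [->|ij] := eqVneq i j.
  by rewrite add0n {1}IHw !mulrA commr_sign.
rewrite mulrA (eC j i) // 1?eq_sym // mulNr -[e i * e j * _]mulrA IHw.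
rewrite exprS mulN1r mulNr.
by congr (- _); rewrite !mulrA commr_sign.
Qed.

(** The first letter of such a word occurs again further on. Moving the second
    occurrence next to the first costs a sign, the two letters then cancel up
    to sign, and the remaining word is shorter and has the same property. *)
Lemma word_even w : {subset w <= t} ->
    (forall i, i \in t -> ~~ odd (count_mem i w)) ->
  exists b : bool, word e w = (-1) ^+ b.
Proof.
have [n] := ubnP (size w); elim: n w => // n IHn [|i w] /=.
  by exists false; rewrite /word big_nil.
rewrite ltnS => lt_wn wt even_w.
have ti : i \in t by apply: wt; rewrite mem_head.
have wi : i \in w.
  by have := even_w i ti; rewrite eqxx /= negbK -has_pred1 has_count;
    case: count.
case/splitPr: wi wt lt_wn even_w => u v wt lt_wn even_w.
have ut : {subset u <= t}.
  by move=> k ku; apply: wt; rewrite inE mem_cat ku orbT.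
have vt : {subset v <= t}.
  by move=> k kv; apply: wt; rewrite inE mem_cat inE kv !orbT.
have [|||b Eb] := IHn (u ++ v).
- by apply: leq_ltn_trans lt_wn; rewrite !size_cat /= addnS.
- by move=> k; rewrite mem_cat => /orP[/ut|/vt].
- move=> k tk; have := even_w k tk; rewrite !count_cat /= !oddD.
  by case: (i == k); case: (odd (count _ u)); case: (odd (count _ v)).
exists (odd (count (predC1 i) u) (+) s i (+) b).
rewrite word_cons word_cat word_cons mulrA (word_swap ti ut) -!mulrA.
rewrite [e i * (_ * _)]mulrA -expr2.
have [_ -> // _] := sys; rewrite !signr_addb -Eb word_cat signr_odd -!mulrA.
by congr (_ * _); rewrite !mulrA commr_sign.
Qed.

Lemma word_rev w : {subset w <= t} ->
  exists b : bool, word e w * word e (rev w) = (-1) ^+ b.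
Proof.
move=> wt; rewrite -word_cat; apply: word_even => [k|i _].
  by rewrite mem_cat mem_rev orbb => /wt.
by rewrite count_cat count_rev addnn odd_double.
Qed.

Lemma sum_count_mem w : {subset w <= t} ->
  (\sum_(i <- t) count_mem i w)%N = size w.
Proof.
case: sys => Ut _ _; elim: w => [_|k w IHw wt] /=; first by rewrite big1.
have tk : k \in t by apply: wt; rewrite mem_head.
rewrite big_split /= IHw => [|i iw]; last by apply: wt; rewrite inE iw orbT.
rewrite (bigD1_seq k) //= eqxx big1 ?addn0 ?add1n // => i.
by rewrite eq_sym => /negbTE->.
Qed.

(** By [word_swap], the hypothesis says that the word commutes with all
    generators for reasons of sign. Under this hypothesis each multiplicity has
    the parity of the length of the word. The length is the sum of these
    multiplicities, an even number of terms of equal parity, hence is even, and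
    [word_even] applies. With an odd number of generators, their product
    commutes with all of them and need not be a sign. *)
Lemma word_central w : ~~ odd (size t) -> {subset w <= t} ->
    (forall i, i \in t -> ~~ odd (count (predC1 i) w)) ->
  exists b : bool, word e w = (-1) ^+ b.
Proof.
move=> even_t wt even_w.
have odd_count i : i \in t -> odd (count_mem i w) = odd (size w).
  move=> ti; rewrite -(count_predC (pred1 i) w) oddD.
  by rewrite -/(predC1 i) (negbTE (even_w i ti)) addbF.
apply: word_even => // i ti; rewrite odd_count // -(sum_count_mem wt).
have {ti} sum_odd u : {subset u <= t} ->
    odd (\sum_(i <- u) count_mem i w) = odd (size u) && odd (size w).
  elim: u => [|k u IHu] ut; first by rewrite big_nil.
  rewrite big_cons oddD IHu => [|j ju]; last by apply: ut; rewrite inE ju orbT.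
  rewrite odd_count ?ut ?mem_head //=.
  by case: (odd (size u)); case: (odd (size w)).
by rewrite sum_odd // (negbTE even_t).
Qed.

Lemma word_eq_sign w1 w2 : ~~ odd (size t) ->
    {subset w1 <= t} -> {subset w2 <= t} ->
    (forall i, i \in t ->
       odd (count (predC1 i) w1) = odd (count (predC1 i) w2)) ->
  exists b : bool, word e w1 = (-1) ^+ b * word e w2.
Proof.
move=> even_t w1t w2t eq12.
have rw2t : {subset rev w2 <= t} by move=> i; rewrite mem_rev; apply: w2t.
have [b1 Eb1] : exists b : bool, word e w1 * word e (rev w2) = (-1) ^+ b.
  rewrite -word_cat; apply: word_central => // i.
    by rewrite mem_cat => /orP[/w1t|/rw2t].
  by move=> /eq12 E; rewrite count_cat oddD count_rev E addbb.
have [b2 Eb2] := word_rev rw2t; rewrite revK in Eb2.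
have E : word e w1 * (-1) ^+ b2 = (-1) ^+ b1 * word e w2.
  by rewrite -Eb1 -Eb2 mulrA.
exists (b1 (+) b2); rewrite addbC signr_addb -mulrA -E commr_sign mulrA.
by rewrite -signr_addb addbb mul1r.
Qed.

End Words.

(** * Linear relations between words *)

Definition lincomb (F : nzRingType) (D : lalgType F) (I : eqType) (e : I -> D)
    (l : seq (F * seq I)) : D :=
  \sum_(k <- l) k.1 *: word e k.2.

Definition words_over (F I : eqType) (t : seq I) (l : seq (F * seq I)) : Prop :=
  {in l, forall k, {subset k.2 <= t}}.

Section Relations.
Variables (F : fieldType) (D A : algType F) (f : {lrmorphism D -> A}).
Hypothesis F2 : (2 : F) != 0.
Variables (I : eqType) (s : I -> bool) (e : I -> D) (t : seq I).
Hypothesis sys : clifford_system s e t.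
Hypothesis even_t : ~~ odd (size t).

Let odd_swap j (k : F * seq I) := odd (count (predC1 j) k.2).

(** Conjugation by a generator multiplies each word by a sign, so a relation
    splits into its parts on which all these signs are constant. Inside a part
    all words agree up to sign, and a word is invertible, so the part is a
    relation only if its total coefficient vanishes. As these signs only depend
    on the words, a relation that holds after applying [f] already holds in
    [D]. *)
Lemma lincomb_relation (l : seq (F * seq I)) :
  words_over t l -> f (lincomb e l) = 0 -> lincomb e l = 0.
Proof.
have [n] := ubnP (size l); elim: n l => // n IHn l lt_ln lt fl0.
have [|/allPn[k1 lk1 /allPn[k2 lk2 /allPn[j tj neq_j]]]] := boolP
    (all (fun k1 => all (fun k2 => all (fun j =>
       odd_swap j k1 == odd_swap j k2) t) l) l).
  case: l lt_ln lt fl0 => [|k0 l] _ lt; first by rewrite /lincomb big_nil.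
  have k0t : {subset k0.2 <= t} by apply: lt; rewrite mem_head.
  set l0 := k0 :: l => fl0 same.
  have [c Ec] : exists c : F, lincomb e l0 = c *: word e k0.2.
    have : {in l0, forall k,
        exists c : F, k.1 *: word e k.2 = c *: word e k0.2}.
      move=> k lk.
      have [||i ti|b ->] :=
        word_eq_sign sys even_t (w1 := k.2) (w2 := k0.2) => //.
      + exact: lt.
      + have /allP/(_ _ (mem_head _ _))/allP/(_ i ti)/eqP := allP same k lk.
        by [].
      by exists (k.1 * (-1) ^+ b); rewrite -scalerA scaler_sign mulr_sign.
    rewrite /lincomb; elim: l0 {lt fl0 same} => [_|k m IHm sc].
      by exists 0; rewrite big_nil scale0r.
    have [i im|c Ec] := IHm; first by apply: sc; rewrite inE im orbT.
    have [d Ed] := sc k (mem_head _ _).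
    by exists (d + c); rewrite big_cons Ec Ed scalerDl.
  have [b Eb] := word_rev sys k0t.
  have : f (c *: word e k0.2) * f (word e (rev k0.2)) = 0.
    by rewrite -Ec fl0 mul0r.
  rewrite linearZ /= -scalerAl -rmorphM Eb rmorph_sign => /eqP.
  rewrite scaler_eq0 signr_eq0 orbF Ec.
  by move=> /eqP->; rewrite scale0r.
(* Moving [e j] across the two halves produces opposite signs, so that the
   image under [f] of each half vanishes. *)
pose P k := odd_swap j k == odd_swap j k1.
have splitl : lincomb e l =
    lincomb e (filter P l) + lincomb e (filter (predC P) l).
  by rewrite /lincomb !big_filter (bigID P).
have sz : (size (filter P l) + size (filter (predC P) l))%N = size l.
  by rewrite !size_filter count_predC.
have P1 : (0 < size (filter P l))%N.
  by rewrite size_filter -has_count; apply/hasP; exists k1 => //; rewrite /P /=.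
have P2 : (0 < size (filter (predC P) l))%N.
  rewrite size_filter -has_count; apply/hasP; exists k2 => //=.
  by rewrite /P eq_sym.
have swap (b : bool) (m : seq (F * seq I)) : {subset m <= l} ->
    {in m, forall k, odd_swap j k = b} ->
  e j * lincomb e m = (-1) ^+ b * (lincomb e m * e j).
  move=> ml mb; rewrite /lincomb mulr_suml !mulr_sumr big_seq [RHS]big_seq.
  apply: eq_bigr => k mk.
  rewrite -scalerAr (word_swap sys) //; last exact/lt/ml.
  by rewrite -signr_odd -/(odd_swap j k) mb // -scalerAl -scalerAr.
have x1 := swap (odd_swap j k1) _ (mem_subseq (filter_subseq P l)).
have x2 := swap (~~ odd_swap j k1) _ (mem_subseq (filter_subseq (predC P) l)).
set m1 := filter P l in splitl sz P1 x1 *.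
set m2 := filter (predC P) l in splitl sz P2 x2 *.
have {}x1 : e j * lincomb e m1 = (-1) ^+ odd_swap j k1 * (lincomb e m1 * e j).
  by apply: x1 => k; rewrite mem_filter => /andP[/eqP].
have {}x2 :
    e j * lincomb e m2 = - ((-1) ^+ odd_swap j k1 * (lincomb e m2 * e j)).
  rewrite -mulNr -signrN; apply: x2 => k; rewrite mem_filter => /andP[/=].
  by rewrite /P; case: odd_swap; case: odd_swap.
have fej u : f (e j) * u = 0 -> u = 0.
  move=> E; have : f (e j) * (f (e j) * u) = 0 by rewrite E mulr0.
  have [_ /(_ j tj) sq_ej _] := sys.
  rewrite mulrA -rmorphM -expr2 sq_ej rmorph_sign mulr_sign.
  by case: (s j) => // /eqP; rewrite oppr_eq0 => /eqP.
have y21 : f (lincomb e m2) = - f (lincomb e m1).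
  by apply/eqP; rewrite -addr_eq0 addrC -rmorphD /= -splitl fl0.
have f10 : f (lincomb e m1) = 0.
  apply: fej.
  have : f (e j) * f (lincomb e m1) = - (f (e j) * f (lincomb e m1)).
    rewrite -[in RHS]mulrN -y21.
    rewrite -[LHS](rmorphM f) -[in RHS](rmorphM f).
    rewrite x1 x2 [in RHS](rmorphN f).
    rewrite !(rmorphM f) rmorph_sign /= y21.
    move: (f (lincomb e m1)) (f (e j)) => y g. by rewrite mulNr mulrN opprK.
  move/eqP; rewrite -subr_eq0 opprK -mulr2n -scaler_nat scaler_eq0.
  by rewrite (negbTE F2) => /eqP.
have f20 : f (lincomb e m2) = 0.
  by rewrite y21 f10 oppr0.
have over m : {subset m <= l} -> words_over t m by move=> ml k /ml/lt.
have m1n : (size m1 < n)%N.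
  by rewrite -ltnS; apply: leq_ltn_trans lt_ln; rewrite -sz -addn1 leq_add2l.
have m2n : (size m2 < n)%N.
  by rewrite -ltnS; apply: leq_ltn_trans lt_ln; rewrite -sz -add1n leq_add2r.
rewrite splitl (IHn m1 m1n _ f10) ?(IHn m2 m2n _ f20) ?addr0 //.
  exact/over/mem_subseq/filter_subseq.
exact/over/mem_subseq/filter_subseq.
Qed.

End Relations.

(** * Algebras generated by equivalent systems *)

Definition in_span (F : nzRingType) (D : lalgType F) (I : eqType) (e : I -> D)
    (t : seq I) (x : D) : Prop :=
  exists2 l : seq (F * seq I), words_over t l & x = lincomb e l.

Section Span.
Variables (F : nzRingType) (D : algType F) (I : eqType) (e : I -> D).
Variable t : seq I.

Lemma in_span0 : in_span e t 0.
Proof. by exists [::]; rewrite /lincomb ?big_nil. Qed.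

Lemma in_spanD x y : in_span e t x -> in_span e t y -> in_span e t (x + y).
Proof.
move=> [l lt ->] [m mt ->]; exists (l ++ m); last by rewrite /lincomb big_cat.
by move=> k; rewrite mem_cat => /orP[/lt|/mt].
Qed.

Lemma in_span_word c w : {subset w <= t} -> in_span e t (c *: word e w).
Proof.
move=> wt; exists [:: (c, w)]; last by rewrite /lincomb big_seq1.
by move=> k; rewrite inE => /eqP->.
Qed.

Lemma in_span_sum (J : eqType) (r : seq J) (x : J -> D) :
  {in r, forall k, in_span e t (x k)} -> in_span e t (\sum_(k <- r) x k).
Proof.
elim: r => [_|k r IHr rx]; first by rewrite big_nil; apply: in_span0.
rewrite big_cons; apply: in_spanD; first by apply: rx; rewrite mem_head.
by apply: IHr => i ir; apply: rx; rewrite inE ir orbT.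
Qed.

Lemma in_spanZ c x : in_span e t x -> in_span e t (c *: x).
Proof.
move=> [l lt ->]; rewrite /lincomb scaler_sumr; apply: in_span_sum => k lk.
by rewrite scalerA; apply: in_span_word; apply: lt.
Qed.

Lemma in_spanM x y : in_span e t x -> in_span e t y -> in_span e t (x * y).
Proof.
move=> [l lt ->] [m mt ->]; rewrite /lincomb mulr_suml.
apply: in_span_sum => k /lt kt; rewrite mulr_sumr.
apply: in_span_sum => i /mt it; rewrite -scalerAl -scalerAr scalerA.
rewrite -word_cat; apply: in_span_word => j.
by rewrite mem_cat => /orP[/kt|/it].
Qed.

End Span.

(** The subalgebra of [A * B] generated by the pairs [(e i, e' i)] is the graph
    of the isomorphism: by [lincomb_relation] for the two projections it meets
    [A * 0] and [0 * B] trivially, and by the spanning hypotheses it projects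
    onto both factors. *)
Theorem clifford_system_iso (F : fieldType) (A B : algType F) (I : eqType)
    (s : I -> bool) (e : I -> A) (e' : I -> B) (t : seq I) :
    (2 : F) != 0 -> ~~ odd (size t) ->
    clifford_system s e t -> clifford_system s e' t ->
    (forall x, in_span e t x) -> (forall y, in_span e' t y) ->
  exists f : {linear A -> B}, bijective f /\ {morph f : x y / x * y}.
Proof.
move=> F2 even_t sysA sysB spanA spanB.
pose d i : (A * B)%type := (e i, e' i).
have sysD : clifford_system s d t.
  case: sysA sysB => Ut eA2 eAC [_ eB2 eBC]; split=> // [i it|i j it jt neq_ij].
    by rewrite expr2 [LHS]surjective_pairing /= -!expr2 eA2 // eB2 //;
      case: (s i).
  by rewrite [LHS]surjective_pairing /= eAC // eBC.
have fst_word w : (word d w).1 = word e w by rewrite /word (rmorph_prod fst).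
have snd_word w : (word d w).2 = word e' w by rewrite /word (rmorph_prod snd).
have fst_comb l : (lincomb d l).1 = lincomb e l.
  rewrite /lincomb (raddf_sum fst); apply: eq_bigr => k _.
  by rewrite -fst_word.
have snd_comb l : (lincomb d l).2 = lincomb e' l.
  rewrite /lincomb (raddf_sum snd); apply: eq_bigr => k _.
  by rewrite -snd_word.
pose graph x y := in_span d t ((x, y) : (A * B)%type).
have fst0 y : graph 0 y -> y = 0.
  case=> l lt E; have := lincomb_relation (f := @fst A B) F2 sysD even_t lt.
  by rewrite -E => /(_ erefl) [].
have snd0 x : graph x 0 -> x = 0.
  case=> l lt E; have := lincomb_relation (f := @snd A B) F2 sysD even_t lt.
  by rewrite -E => /(_ erefl) [].
have graphB x y x' y' : graph x y -> graph x' y' -> graph (x - x') (y - y').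
  move=> xy /(in_spanZ (-1)); rewrite scaleN1r => x'y'.
  exact: in_spanD xy x'y'.
have fst_inj x y y' : graph x y -> graph x y' -> y = y'.
  by move=> xy /(graphB _ _ _ _ xy); rewrite subrr => /fst0/subr0_eq.
have snd_inj x x' y : graph x y -> graph x' y -> x = x'.
  by move=> xy /(graphB _ _ _ _ xy); rewrite subrr => /snd0/subr0_eq.
have [f fP] : {f & forall x, graph x (f x)}.
  apply: boolp.choice => x; have [l lt ->] := spanA x; exists (lincomb e' l).
  by exists l => //; rewrite -fst_comb -snd_comb -surjective_pairing.
have [g gP] : {g & forall y, graph (g y) y}.
  apply: (@boolp.choice B A (fun y x => graph x y)) => y.
  have [l lt ->] := spanB y; exists (lincomb e l).
  by exists l => //; rewrite -fst_comb -snd_comb -surjective_pairing.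
have f_linear : linear f.
  move=> c x y; apply: fst_inj (fP _) _.
  exact: in_spanD (in_spanZ c (fP x)) (fP y).
pose fL := GRing.isLinear.Build F A B *:%R f f_linear.
exists (HB.pack_for {linear A -> B} f fL); split=> /=.
  exists g => x; first exact: snd_inj (gP _) (fP _).
  exact: fst_inj (fP _) (gP _).
by move=> x y; apply: fst_inj (fP _) _; apply: in_spanM (fP x) (fP y).
Qed.

(** * Building a generating system *)

(** For a set [J] of generators, the product over [J] anticommutes with [e i]
    when [J] without [i] has odd size. Let [S] be the set of generators that
    anticommute with [x]. If [S] has even size, the choice [J = S] gives the
    product the same signs as [x]; if [S] has odd size, so does its complement,
    and [J] is that complement. *)
Lemma word_adjust (D : nzRingType) (I : eqType) (s : I -> bool) (e : I -> D)
    (t : seq I) (a : I -> bool) (x : D) :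
    clifford_system s e t -> ~~ odd (size t) ->
    {in t, forall i, e i * x = (-1) ^+ a i * (x * e i)} ->
  exists2 w, {subset w <= t} &
    {in t, forall i, GRing.comm (e i) (x * word e w)}.
Proof.
move=> sys even_t xe; have [Ut _ _] := sys.
pose J i := a i (+) odd (count a t).
have wt : {subset filter J t <= t} by exact/mem_subseq/filter_subseq.
exists (filter J t) => // i ti; rewrite /GRing.comm mulrA xe //.
have oddJ : odd (count J t) = odd (count a t).
  rewrite /J; case: (boolP (odd (count a t))) => [odd_a|/negbTE even_a].
    rewrite (eq_count (a2 := predC a)) => [|k]; last by rewrite addbT.
    have := congr1 odd (count_predC a t).
    by rewrite oddD odd_a (negbTE even_t) => /negbFE.
  by rewrite (eq_count (a2 := a)) => [//|k]; rewrite addbF.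
have count_i : (count_mem i (filter J t) = J i)%N.
  by rewrite count_uniq_mem ?filter_uniq // mem_filter ti andbT.
have odd_i : odd (count (predC1 i) (filter J t)) = a i.
  have := congr1 odd (count_predC (pred1 i) (filter J t)).
  rewrite oddD size_filter oddJ count_i oddb (erefl : J i = a i (+) _).
  by move: (odd (count (predC1 i) _)) (a i) (odd (count a t)) => [] [] [].
rewrite -!mulrA (word_swap sys ti wt) -[_ ^+ count _ _]signr_odd odd_i.
rewrite [x * (_ ^+ _ * _)]mulrA commr_sign -!mulrA [LHS]mulrA -signr_addb.
by rewrite addbb mul1r.
Qed.

Definition central_scalars (F : fieldType) (A : algType F) : Prop :=
  forall x : A, (forall y, x * y = y * x) -> exists c : F, x = c%:A.

(** What the proof retains of the nonzero homogeneous elements of a graded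
    commutative algebra in which they are regular. The grading group is
    forgotten; this makes it possible to change the ground field, in
    [sign_commutative_complex]. The bound [sc_bound] is what remains of finite
    dimension. *)
Record sign_commutative (F : fieldType) (A : algType F) (H : A -> Prop) :
  Prop :=
  SignCommutative {
    sc_nz : ~ H 0;
    sc_mul : forall x y, H x -> H y -> H (x * y);
    sc_scale : forall c x, c != 0 -> H x -> H (c *: x);
    sc_comm : forall x y, H x -> H y -> x * y = y * x \/ x * y = - (y * x);
    sc_span : forall x : A, exists2 l : seq A,
      {in l, forall h, H h} & x = \sum_(h <- l) h;
    sc_bound : exists N, forall s (t : seq A),
      clifford_system s id t -> (size t <= N)%N }.

Section Growth.
Variables (F : fieldType) (A : algType F) (H : A -> Prop).
Hypothesis F2 : (2 : F) != 0.
Hypothesis sqrtF : forall c : F, c != 0 ->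
  exists d (b : bool), d ^+ 2 * c = (-1) ^+ b.
Hypotheses (scH : sign_commutative H) (central : central_scalars A).

Lemma central_of_generators x : (forall h, H h -> x * h = h * x) ->
  exists c : F, x = c%:A.
Proof.
move=> xH; apply: central => y; have [l lH ->] := sc_span scH y.
rewrite mulr_sumr mulr_suml big_seq [RHS]big_seq; apply: eq_bigr => h /lH.
exact: xH.
Qed.

Lemma sc_neq0 x : H x -> x != 0.
Proof. by move=> Hx; apply/eqP => x0; apply: (sc_nz scH); rewrite -x0. Qed.

Lemma eq_opp0 (x : A) : x = - x -> x = 0.
Proof.
move/eqP; rewrite -subr_eq0 opprK -mulr2n -scaler_nat scaler_eq0 (negbTE F2).
by move/eqP.
Qed.

Lemma sc_sqr_scalar x : H x -> exists c : F, x ^+ 2 = c%:A /\ c != 0.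
Proof.
move=> Hx; have [c Ec] : exists c : F, x ^+ 2 = c%:A.
  apply: central_of_generators => h Hh; rewrite !expr2 mulrA -mulrA.
  have [E|E] := sc_comm scH Hx Hh; first by rewrite E !mulrA E.
  by rewrite E mulrN !mulrA E mulNr opprK.
exists c; split=> //; apply: contraTneq (sc_neq0 (sc_mul scH Hx Hx)) => c0.
by rewrite -expr2 Ec c0 scale0r eqxx.
Qed.

(** The square of [x] commutes with [H], two signs cancelling, so it is a
    nonzero scalar; the hypothesis on the ground field reduces it to a sign. *)
Lemma sc_normalise x : H x ->
  exists d (b : bool), [/\ d != 0, H (d *: x) & (d *: x) ^+ 2 = (-1) ^+ b].
Proof.
move=> Hx; have [c [x2 c_neq0]] := sc_sqr_scalar Hx.
have [d [b Ed]] := sqrtF c_neq0.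
have d_neq0 : d != 0.
  by apply: contra_eq_neq Ed => ->; rewrite expr0n mul0r eq_sym signr_eq0.
exists d, b; split=> //; first exact: sc_scale.
by rewrite exprZn x2 scalerA Ed scaler_sign; case: b {Ed}.
Qed.

Lemma sc_word w x : {in w, forall h, H h} -> H x -> H (x * word id w).
Proof.
elim/last_ind: w => [|w h IHw] Hw Hx; first by rewrite /word big_nil mulr1.
rewrite -cats1 word_cat {2}/word big_seq1 mulrA; apply: (sc_mul scH).
  by apply: IHw => // k kw; apply: Hw; rewrite mem_rcons inE kw orbT.
by apply: Hw; rewrite mem_rcons mem_head.
Qed.

Lemma sc_adjust (s : A -> bool) (t : seq A) x :
    clifford_system s id t -> ~~ odd (size t) -> {in t, forall h, H h} -> H x ->
  exists w, [/\ {subset w <= t}, H (x * word id w)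
    & {in t, forall h, GRing.comm h (x * word id w)}].
Proof.
move=> sys even_t tH Hx; have [//|w wt wC] :=
    word_adjust (a := fun h => h * x != x * h) (x := x) sys even_t _.
  move=> h /tH Hh /=; rewrite mulr_sign; case: eqVneq => //= neq_hx.
  by case: (sc_comm scH Hh Hx) => // E; rewrite E eqxx in neq_hx.
by exists w; split=> //; apply: sc_word => // h /wt/tH.
Qed.

(** Any [h] in [H] becomes central, hence scalar, after multiplication by a
    suitable word [w], so [h] is a multiple of the inverse of [w], which up to
    sign is the reversed word. *)
Lemma maximal_system_spans (s : A -> bool) (t : seq A) :
    clifford_system s id t -> ~~ odd (size t) -> {in t, forall h, H h} ->
    (forall x, H x -> {in t, forall h, GRing.comm h x} ->
       forall y, H y -> x * y = y * x) ->
  forall x, in_span id t x.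
Proof.
move=> sys even_t tH cent x; have [l lH ->] := sc_span scH x.
apply: in_span_sum => h /lH Hh.
have [w [wt Hhw hwC]] := sc_adjust sys even_t tH Hh.
have [c Ec] := central_of_generators (cent _ Hhw hwC).
have [b Eb] := word_rev sys wt.
have -> : h = ((-1) ^+ b * c) *: word id (rev w).
  rewrite -scalerA; have -> : c *: word id (rev w) = h * (-1) ^+ b.
    by rewrite -Eb mulrA Ec -scalerAl mul1r.
  by rewrite commr_sign scaler_sign mulr_sign; case: b {Eb}; rewrite ?opprK.
by apply: in_span_word => i; rewrite mem_rev; apply: wt.
Qed.

Lemma clifford_system_cons (s : A -> bool) (t : seq A) (b : bool) x :
    clifford_system s id t -> x ^+ 2 = (-1) ^+ b ->
    {in t, forall h, x * h = - (h * x)} ->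
  clifford_system (fun h => if h == x then b else s h) id (x :: t).
Proof.
move=> [Ut t2 tC] x2 xC.
have xt : x \notin t.
  apply/negP => /xC /eq_opp0; rewrite -expr2 x2 => /eqP.
  by rewrite signr_eq0.
split=> [|h|g h]; first by rewrite /= xt.
  rewrite inE; case: eqVneq => [->|_] //=; exact: t2.
rewrite !inE => /predU1P[->|tg] /predU1P[->|th]; first by rewrite eqxx.
- by move=> _; apply: xC.
- by move=> _; rewrite xC // opprK.
exact: tC.
Qed.

(** Replacing [y] by [y * word w] makes both elements commute with [t]; they
    still do not commute with each other. The product [o] of all of [t]
    anticommutes with each generator because their number is even, hence so do
    [o * x] and [o * y], which also anticommute with each other. *)
Lemma clifford_system_extend (s : A -> bool) (t : seq A) x y :
    clifford_system s id t -> ~~ odd (size t) -> {in t, forall h, H h} ->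
    H x -> H y -> {in t, forall h, GRing.comm h x} -> x * y <> y * x ->
  exists s' t', [/\ clifford_system s' id t', size t' = (size t).+2
    & {in t', forall h, H h}].
Proof.
move=> sys even_t tH Hx Hy xt neq_xy.
have [w [wt Hyw ywC]] := sc_adjust sys even_t tH Hy.
set g := y * word id w in Hyw ywC.
have comm_word u z : {subset u <= t} -> {in t, forall h, GRing.comm h z} ->
    GRing.comm z (word id u).
  move=> ut zC; rewrite /word big_seq; elim/big_ind: _ => [|a b|h hu].
  - exact: commr1.
  - exact: commrM.
  exact/commr_sym/zC/ut.
have xy : x * y = - (y * x) by case: (sc_comm scH Hx Hy).
have xg : x * g = - (g * x).
  by rewrite mulrA xy mulNr -mulrA (comm_word w x wt xt) mulrA.
clearbody g; set o := word id t.
have oH z : H z -> H (o * z).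
  rewrite /o /word; move: tH; elim: (t) => [|h u IHu] uH Hz.
    by rewrite big_nil mul1r.
  rewrite big_cons -mulrA; apply: (sc_mul scH).
    by apply: uH; rewrite mem_head.
  by apply: IHu => // k ku; apply: uH; rewrite inE ku orbT.
have ot h : h \in t -> h * o = - (o * h).
  move=> th; rewrite (word_swap sys th) // -signr_odd.
  suff -> : odd (count (predC1 h) t) by rewrite mulN1r.
  have [Ut _ _] := sys; have := congr1 odd (count_predC (pred1 h) t).
  by rewrite oddD (count_uniq_mem _ Ut) th (negbTE even_t) => /negbFE.
have ozt z : {in t, forall h, GRing.comm h z} ->
    {in t, forall h, o * z * h = - (h * (o * z))}.
  by move=> zC h th; rewrite -mulrA -(zC h th) !mulrA ot // mulNr opprK.
have oxg : o * g * (o * x) = - (o * x * (o * g)).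
  rewrite -!mulrA; rewrite [g * _]mulrA (comm_word t g) // [x * (o * _)]mulrA.
  by rewrite (comm_word t x) // -!mulrA xg !mulrN opprK.
have [c [b [c0 Hc c2]]] := sc_normalise (oH x Hx).
have [d [b' [d0 Hd d2]]] := sc_normalise (oH g Hyw).
have scaled k z : {in t, forall h, GRing.comm h z} ->
    {in t, forall h, (k *: (o * z)) * h = - (h * (k *: (o * z)))}.
  by move=> zC h th; rewrite -scalerAl ozt // -scalerAr scalerN.
have sys1 := clifford_system_cons sys c2 (scaled c x xt).
set u := c *: (o * x) in Hc c2 sys1.
have gC : {in u :: t, forall h, d *: (o * g) * h = - (h * (d *: (o * g)))}.
  move=> h; rewrite inE => /predU1P[->|]; last exact: scaled.
  by rewrite -!scalerAl -!scalerAr oxg !scalerN !scalerA [c * d]mulrC.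
have sys2 := clifford_system_cons sys1 d2 gC.
eexists; exists [:: d *: (o * g), u & t]; split; [exact: sys2 | by [] |].
by move=> h; rewrite !inE => /or3P[/eqP->|/eqP->|/tH].
Qed.

Theorem exists_spanning_system : exists s (t : seq A),
  [/\ clifford_system s id t, ~~ odd (size t) & forall x, in_span id t x].
Proof.
have [N bound] := sc_bound scH.
suff grow n (s : A -> bool) (t : seq A) : (N < size t + n)%N ->
    clifford_system s id t -> ~~ odd (size t) -> {in t, forall h, H h} ->
  exists s (t : seq A),
    [/\ clifford_system s id t, ~~ odd (size t) & forall x, in_span id t x].
  by apply: (grow N.+1 xpred0 [::]).
elim: n s t => [|n IHn] s t lt_N sys even_t tH.
  by have := bound _ _ sys; rewrite leqNgt -[size t]addn0 lt_N.
have [[x [y [Hx xt Hy neq_xy]]]|maxt] := pselect (exists x y,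
    [/\ H x, {in t, forall h, GRing.comm h x}, H y & x * y <> y * x]).
  have [s' [t' [sys' sz t'H]]] :=
    clifford_system_extend sys even_t tH Hx Hy xt neq_xy.
  apply: IHn sys' _ t'H; rewrite sz ?negbK //.
  by apply: leq_trans lt_N _; rewrite addnS addSn leqW ?leqnn.
exists s, t; split=> //.
apply: (maximal_system_spans sys even_t tH) => x Hx xt y Hy.
by apply: contra_notP maxt => neq_xy; exists x, y.
Qed.

End Growth.

(** * The generators of a Clifford algebra *)

Lemma clifford_system_enum (F : fieldType) (A : algType F) (s : A -> bool)
    (t : seq A) :
    clifford_system s id t -> (forall x, in_span id t x) ->
  exists p q (e : 'I_(p + q) -> A),
    [/\ clifford_system (fun i : 'I_(p + q) => p <= i)%N e (enum 'I_(p + q)),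
        (p + q = size t)%N & forall x, in_span e (enum 'I_(p + q)) x].
Proof.
move=> [Ut t2 tC] spant.
pose t1 := filter (predC s) t; pose t2' := filter s t.
pose u := t1 ++ t2'; pose p := size t1; pose q := size t2'.
have ut : perm_eq u t by rewrite /u perm_catC; apply/permPl/perm_filterC.
have Uu : uniq u by rewrite (perm_uniq ut).
have sz : size u = (p + q)%N by rewrite size_cat.
pose e (i : 'I_(p + q)) := nth 0 u i.
have ei (i : 'I_(p + q)) : e i \in t.
  by rewrite -(perm_mem ut) mem_nth // sz.
have e_inj : injective e.
  move=> i j /eqP; rewrite nth_uniq ?sz // => /eqP ij; exact: val_inj.
exists p, q, e; split.
- split=> [|i _|i j _ _ neq_ij]; first exact: enum_uniq.
    rewrite t2 // /e nth_cat -/p; case: ltnP => [lt_ip|le_pi].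
      have : nth 0 t1 i \in t1 by rewrite mem_nth.
      by rewrite mem_filter => /andP[/negbTE->].
    have : nth 0 t2' (i - p) \in t2' by rewrite mem_nth // ltn_subLR.
    by rewrite mem_filter => /andP[->].
  by apply: tC => //; apply: contra_neq neq_ij => /e_inj.
- by rewrite -sz (perm_size ut).
have lift w : {subset w <= t} -> exists w', word id w = word e w'.
  elim: w => [_|x w IHw wt]; first by exists [::]; rewrite /word !big_nil.
  have [y yw|w' Ew] := IHw; first by apply: wt; rewrite inE yw orbT.
  have ux : x \in u by rewrite (perm_mem ut) wt ?mem_head.
  have lt_x : (index x u < p + q)%N by rewrite -sz index_mem.
  exists (Ordinal lt_x :: w').
  by rewrite !word_cons Ew {2}/e /= nth_index.
move=> x; have [l lt ->] := spant x; apply: in_span_sum => k /lt/lift[w ->].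
by apply: in_span_word => i _; rewrite mem_enum.
Qed.

Section CliffordGenerators.
Variables (R : comNzRingType) (p q : nat).

Definition clifford_gen (i : 'I_(p + q)) : clifford R p q :=
  \pi_(clifford R p q)%qT (free_gen R i).

Let pi := (\pi_(clifford R p q)%qT : free_alg R p q -> clifford R p q).

Lemma clifford_pi_relation x y : clifford_relation (x - y) -> pi x = pi y.
Proof.
move=> rel; apply/clifford_piP/asboolP => J _ _ _; exact.
Qed.

Lemma clifford_gen_system : clifford_system (fun i : 'I_(p + q) => p <= i)%N
  clifford_gen (enum 'I_(p + q)).
Proof.
have piM x y : pi (x * y) = pi x * pi y by apply: clifford_piM.
have pi1 : pi 1 = 1 by [].
have piN x : pi (- x) = - pi x.
  apply/eqP; rewrite -subr_eq0 opprK -[_ + _]clifford_piD addNr.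
  by apply/eqP; rewrite [RHS](_ : _ = pi 0) //; rewrite !piE.
split=> [|i _|i j _ _ neq_ij]; first exact: enum_uniq.
  rewrite expr2 -piM; case: leqP => [le_pi|lt_ip].
    rewrite expr1 -[1 in RHS]pi1 -piN.
    exact/clifford_pi_relation/clifford_square_neg.
  exact/clifford_pi_relation/clifford_square_pos.
rewrite -!piM -piN; exact/clifford_pi_relation/clifford_anticommute.
Qed.

End CliffordGenerators.

(** A monomial of the free algebra is the product of its letters. *)
Lemma clifford_gen_span (F : fieldType) p q (z : clifford F p q) :
  in_span (@clifford_gen F p q) (enum 'I_(p + q)) z.
Proof.
pose pi := (\pi_(clifford F p q)%qT : free_alg F p q -> clifford F p q).
have piM x y : pi (x * y) = pi x * pi y by apply: clifford_piM.
have piZ c x : pi (c *: x) = c *: pi x by apply: clifford_piZ.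
have pi_sum (J : Type) (r : seq J) (G : J -> free_alg F p q) :
    pi (\sum_(k <- r) G k) = \sum_(k <- r) pi (G k).
  elim: r => [|k r IHr]; last by rewrite !big_cons -IHr; apply: clifford_piD.
  by rewrite !big_nil /pi !piE.
have prodE (w : seq 'I_(p + q)) :
    mkmalgU (FMonom w) 1 = \prod_(i <- w) free_gen F i :> free_alg F p q.
  elim: w => [|i w IHw].
    by rewrite big_nil; congr mkmalgU; apply/val_inj; rewrite /= fm1.
  rewrite big_cons -IHw malgM_def fgmulUU mulr1; congr mkmalgU.
  by apply/val_inj; rewrite /= fmM fmuE.
have pi_prod (w : seq 'I_(p + q)) :
    pi (\prod_(i <- w) free_gen F i) = word (@clifford_gen F p q) w.
  rewrite /word; elim: w => [|i w IHw]; first by rewrite !big_nil.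
  by rewrite !big_cons piM IHw.
elim/quotW: z => a; rewrite -/(pi a) [a]monalgE pi_sum.
apply: in_span_sum => -[w] _.
have -> : mkmalgU (FMonom w) (mcoeff (FMonom w) a) =
    mcoeff (FMonom w) a *: mkmalgU (FMonom w) 1.
  by apply/malgP => k; rewrite mcoeffZ !mcoeffU mulrnAr mulr1.
rewrite piZ prodE pi_prod; apply: in_span_word => i _; exact: mem_enum.
Qed.

(** * Complex structures *)

Section ComplexificationGenerators.
Variables (R : rcfType) (B : algType R) (I : eqType) (s : I -> bool).
Variables (e : I -> B) (t : seq I).

Definition cplx_gen (i : I) : complexification B := (e i, 0).

Lemma cplx_mul_real (x y : B) :
  ((x, 0) : complexification B) * ((y, 0) : complexification B) = (x * y, 0).
Proof. by congr pair; rewrite /= ?(mulr0, mul0r) ?subr0 ?addr0. Qed.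

Lemma cplx_gen_system : clifford_system s e t -> clifford_system s cplx_gen t.
Proof.
move=> [Ut e2 eC]; split=> // [i ti|i j ti tj neq_ij].
  rewrite expr2 cplx_mul_real -expr2 e2 //; case: (s i) => //.
  by congr pair; rewrite oppr0.
by rewrite !cplx_mul_real eC //; congr pair; rewrite oppr0.
Qed.

Lemma word_cplx_gen w : word cplx_gen w = (word e w, 0).
Proof.
elim: w => [|i w IHw]; first by rewrite /word !big_nil.
by rewrite !word_cons IHw cplx_mul_real.
Qed.

Lemma cplx_scaleE (c : R[i]) (u : complexification B) : c *: u =
  (complex.Re c *: u.1 - complex.Im c *: u.2,
   complex.Re c *: u.2 + complex.Im c *: u.1).
Proof. by []. Qed.

Lemma cplx_gen_span : (forall x, in_span e t x) ->
  forall u, in_span cplx_gen t u.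
Proof.
move=> spane.
have real x : in_span cplx_gen t ((x, 0) : complexification B).
  have [l lt ->] := spane x; rewrite /lincomb.
  have -> : ((\sum_(k <- l) k.1 *: word e k.2, 0) : complexification B) =
      \sum_(k <- l) (k.1)%:C%C *: word cplx_gen k.2.
    elim: {lt} l => [|k l IHl]; first by rewrite !big_nil.
    rewrite !big_cons -IHl word_cplx_gen cplx_scaleE /=.
    by congr pair; rewrite ?(scale0r, scaler0, subr0, addr0).
  by apply: in_span_sum => k lk; apply/in_span_word/lt.
move=> [x y].
suff -> : ((x, y) : complexification B) = ((x, 0) : complexification B) +
    'i%C *: ((y, 0) : complexification B).
  exact/in_spanD/in_spanZ.
rewrite cplx_scaleE /=.
by congr pair;
  rewrite /= ?(scale0r, scaler0, scale1r, sub0r, add0r, subr0, addr0, oppr0).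
Qed.

End ComplexificationGenerators.

(** When [j] is central with square [-1], the real algebra [A] is an algebra
    over [R[i]] in which ['i] acts as multiplication by [j]. The two hypotheses
    are parameters of the carrier so that the instances below can find them. *)
Definition complex_structure (R : rcfType) (A : algType R) (j : A)
  (jC : forall x, j * x = x * j) (j2 : j ^+ 2 = -1) : Type := A.

Section ComplexStructure.
Variables (R : rcfType) (A : algType R) (j : A).
Hypotheses (jC : forall x, j * x = x * j) (j2 : j ^+ 2 = -1).
Local Notation AC := (complex_structure jC j2).

HB.instance Definition _ := GRing.NzRing.copy AC A.

Definition cstruct_scale (c : R[i]) (x : A) : A :=
  complex.Re c *: x + complex.Im c *: (j * x).

Lemma cstruct_scaleA c d x :
  cstruct_scale c (cstruct_scale d x) = cstruct_scale (c * d) x.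
Proof.
case: c d => [a b] [c d]; rewrite /cstruct_scale /=.
rewrite mulrDr -!scalerAr mulrA -expr2 j2 mulN1r.
rewrite !(scalerBr, scalerDr) !scalerN !scalerA scalerBl scalerDl !addrA.
by rewrite [LHS](ACl (1*4*2*3)).
Qed.

Lemma cstruct_scale1 : left_id 1 cstruct_scale.
Proof. by move=> x; rewrite /cstruct_scale /= scale1r scale0r addr0. Qed.

Lemma cstruct_scaleDr : right_distributive cstruct_scale +%R.
Proof.
by move=> c x y; rewrite /cstruct_scale mulrDr !scalerDr addrACA.
Qed.

Lemma cstruct_scaleDl x :
  {morph cstruct_scale^~ x : c d / c + d >-> c + d}.
Proof.
by move=> [a b] [c d]; rewrite /cstruct_scale /= !scalerDl addrACA.
Qed.

HB.instance Definition _ := GRing.Zmodule_isLmodule.Build R[i] AC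
  cstruct_scaleA cstruct_scale1 cstruct_scaleDr cstruct_scaleDl.

Lemma cstruct_scaleAl (c : R[i]) (x y : AC) : c *: (x * y) = (c *: x) * y.
Proof.
rewrite -[LHS]/(cstruct_scale c (x * y)) -[c *: x]/(cstruct_scale c x).
by rewrite /cstruct_scale [RHS](@mulrDl A) -!(@scalerAl R A) mulrA.
Qed.

Lemma cstruct_scaleAr (c : R[i]) (x y : AC) : c *: (x * y) = x * (c *: y).
Proof.
rewrite -[LHS]/(cstruct_scale c (x * y)) -[c *: y]/(cstruct_scale c y).
rewrite /cstruct_scale [RHS](@mulrDr A) -!(@scalerAr R A) !(@mulrA A).
by rewrite -(jC x).
Qed.

HB.instance Definition _ := GRing.Lmodule_isLalgebra.Build R[i] AC
  cstruct_scaleAl.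
HB.instance Definition _ := GRing.Lalgebra_isAlgebra.Build R[i] AC
  cstruct_scaleAr.

Lemma cstruct_scaleE (c : R[i]) (x : AC) :
  c *: x = complex.Re c *: (x : A) + complex.Im c *: (j * x) :> A.
Proof. by []. Qed.

End ComplexStructure.

(** * The centre of a finite-dimensional algebra *)

Section Finite.
Variables (K : fieldType) (A : falgType K).

(** Anticommuting generators are linearly independent: the anticommutator of
    [x] in [t] with a relation retains only the coefficient of [x]. *)
Lemma clifford_system_bound (s : A -> bool) (t : seq A) : (2 : K) != 0 ->
  clifford_system s id t -> (size t <= \dim {:A})%N.
Proof.
move=> K2 [Ut t2 tC].
suff /eqP <- : free t by apply/dimvS/subvf.
apply/(@freeP K A _ (in_tuple t)) => k k0 i.
have ti (l : 'I_(size t)) : t`_l \in t by apply: mem_nth.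
have : \sum_(l < size t) k l *: (t`_i * t`_l + t`_l * t`_i) = 0.
  transitivity (t`_i * (\sum_(l < size t) k l *: t`_l) +
                (\sum_(l < size t) k l *: t`_l) * t`_i).
    rewrite mulr_sumr mulr_suml -big_split; apply: eq_bigr => l _.
    by rewrite -scalerAr -scalerAl scalerDr.
  by rewrite k0 mulr0 mul0r addr0.
rewrite (bigD1 i) //= big1 ?addr0 => [|l neq_li].
  rewrite -mulr2n -scaler_nat scalerA -expr2 t2 ?ti // => /eqP.
  rewrite scaler_eq0 signr_eq0 orbF mulf_eq0 (negbTE K2) orbF.
  by move/eqP.
by rewrite (tC _ _ (ti i)) ?ti // ?addNr ?scaler0 // nth_uniq // eq_sym.
Qed.

(** The powers of [z] up to the dimension of [A] are linearly dependent. *)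
Lemma annihilating_poly (z : A) :
  exists2 p : {poly K}, p != 0 & horner_alg z p = 0.
Proof.
apply: contrapT => noP; pose n := \dim {:A}.
pose X := [tuple z ^+ i | i < n.+1].
suff /eqP E : free X.
  by have := dimvS (subvf <<X>>%VS); rewrite E size_tuple ltnn.
apply/freeP => k k0 i; pose p := \poly_(l < n.+1) k (inord l).
have pz : horner_alg z p = 0.
  rewrite /p poly_def linear_sum -[RHS]k0; apply: eq_bigr => l _.
  rewrite linearZ /= rmorphXn /= horner_algX inord_val.
  rewrite -(tnth_nth 0 X) tnth_mktuple.
  by rewrite -scalerAl mul1r.
have : p = 0 by apply: contrapT => /eqP p_neq0; apply: noP; exists p.
move=> /(congr1 (fun q : {poly K} => q`_i)).
by rewrite coef_poly ltn_ord coef0 inord_val.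
Qed.

End Finite.

(** In a simple algebra a nonzero central element generates an ideal, hence is
    not a zero divisor; this is the only form in which simplicity enters the
    study of the centre. *)
Definition central_regular (A : nzRingType) :=
  forall x y : A, (forall u, x * u = u * x) -> x * y = 0 -> x = 0 \/ y = 0.

Lemma horner_alg_central (K : fieldType) (A : algType K) (z : A)
    (p : {poly K}) :
    (forall u, z * u = u * z) ->
  forall u, horner_alg z p * u = u * horner_alg z p.
Proof.
move=> zC u; elim/poly_ind: p => [|p c IHp].
  by rewrite rmorph0 mul0r mulr0.
rewrite rmorphD rmorphM /= horner_algX horner_algC mulrDl mulrDr.
by rewrite -[_ * z * u]mulrA zC !mulrA IHp -scalerAl -scalerAr mul1r mulr1.
Qed.

(** Factor a polynomial that annihilates [z] into linear factors: one of them
    vanishes at [z]. *)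
Lemma central_scalar_closed (K : closedFieldType) (A : falgType K) (z : A) :
    central_regular A -> (forall u, z * u = u * z) ->
  exists c : K, z = c%:A.
Proof.
move=> reg zC; have [p] := annihilating_poly z.
have [n] := ubnP (size p); elim: n p => // n IHn p lt_n p_neq0 pz.
have [|] := eqVneq (size p) 1%N.
  move/eqP/size_poly1P => [c c_neq0 Ep]; move: pz.
  rewrite Ep horner_algC => /eqP; rewrite scaler_eq0 (negbTE c_neq0).
  by rewrite oner_eq0.
move=> /closed_rootP[c /factor_theorem[q Eq]].
have q_neq0 : q != 0 by apply: contraNneq p_neq0 => q0; rewrite Eq q0 mul0r.
move: pz; rewrite Eq rmorphM => /(reg _ _ (horner_alg_central q zC)) [qz|].
  apply: (IHn q) => //; move: lt_n.
  by rewrite Eq size_Mmonic ?monicXsubC // size_XsubC addn2.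
rewrite rmorphB /= horner_algX horner_algC => /eqP.
by rewrite subr_eq0 => /eqP->; exists c.
Qed.

(** As in [central_scalar_closed], with factors of degree one or two over the
    reals: a complex root with nonzero imaginary part is a root of a real
    quadratic polynomial, which divides the annihilating polynomial. *)
Lemma central_quadratic_real (R : rcfType) (A : falgType R) (z : A) :
    central_regular A -> (forall u, z * u = u * z) ->
  (exists c : R, z = c%:A) \/
  (exists a b : R, b != 0 /\ (z - a%:A) ^+ 2 = - (b ^+ 2)%:A).
Proof.
move=> reg zC; have [p] := annihilating_poly z.
have [n] := ubnP (size p); elim: n p => // n IHn p lt_n p_neq0 pz.
have [|] := eqVneq (size p) 1%N.
  move/eqP/size_poly1P => [c c_neq0 Ep]; move: pz.
  rewrite Ep horner_algC => /eqP; rewrite scaler_eq0 (negbTE c_neq0).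
  by rewrite oner_eq0.
rewrite -(size_map_poly (real_complex R)) => /closed_rootP[[a b] rt].
have factor (q r : {poly R}) : p = r * q -> q \is monic -> (1 < size q)%N ->
    horner_alg z q = 0 \/
    ((exists c : R, z = c%:A) \/
     (exists a b : R, b != 0 /\ (z - a%:A) ^+ 2 = - (b ^+ 2)%:A)).
  move=> Eq mon_q lt1q.
  have r_neq0 : r != 0 by apply: contraNneq p_neq0 => r0; rewrite Eq r0 mul0r.
  move: pz; rewrite Eq rmorphM => /(reg _ _ (horner_alg_central r zC)) [rz|->].
    right; apply: (IHn r) => //; rewrite -ltnS; apply: leq_ltn_trans lt_n.
    rewrite Eq size_Mmonic // -subn1 -addnBA ?(ltnW lt1q) //.
    by rewrite -addn1 leq_add2l subn_gt0.
  by left.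
have [b0|b_neq0] := eqVneq b 0.
  have : root p a by rewrite -(fmorph_root (real_complex R)); rewrite b0 in rt.
  move=> /factor_theorem[q Eq].
  have [|||//] := factor _ _ Eq; rewrite ?monicXsubC ?size_XsubC //.
  rewrite rmorphB /= horner_algX horner_algC => /eqP; rewrite subr_eq0 => /eqP.
  by left; exists a.
(* The minimal polynomial of the complex root. *)
pose q : {poly R} := ('X - a%:P) ^+ 2 + (b ^+ 2)%:P.
have szq2 : size (('X - a%:P) ^+ 2 : {poly R}) = 3 by rewrite size_exp_XsubC.
have szq : size q = 3.
  by rewrite size_polyDl szq2 // ltnS (leq_trans (size_polyC_leq1 _)).
have mon_q : q \is monic.
  rewrite monicE lead_coefDl ?szq2 ?ltnS ?(leq_trans (size_polyC_leq1 _)) //.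
  by rewrite -monicE rpredX ?monicXsubC.
have dvd_q : p = p %/ q * q.
  rewrite {1}(divp_eq p q); set r := p %% q; suff -> : r = 0 by rewrite addr0.
  have szr : (size r <= 2)%N.
    by have := ltn_modp p q; rewrite -size_poly_eq0 szq.
  have : root (map_poly (real_complex R) r) (a +i* b)%C.
    have -> : r = p - p %/ q * q.
      by apply/esym/eqP; rewrite subr_eq addrC /r -divp_eq.
    rewrite rmorphB rmorphM /= /root hornerD hornerN hornerM (eqP rt).
    rewrite add0r oppr_eq0.
    rewrite /q rmorphD rmorphXn rmorphB /= map_polyX !map_polyC /=.
    rewrite !hornerE /= [X in _ * X](_ : _ = 0) ?mulr0 //; apply/eqP.
    rewrite expr2 eq_complex /=.
    rewrite !subrr !mul0r mulr0 subr0 -expr2 sub0r.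
    by rewrite addNr !addr0 eqxx.
  rewrite /root (horner_coef_wide (n := 2)) ?size_map_poly //.
  rewrite !big_ord_recl big_ord0.
  rewrite !coef_map /= expr0 expr1 addr0.
  rewrite eq_complex /= !(mulr1, mulr0, mul0r, addr0, add0r, subr0) => /andP[].
  rewrite [_ * b == 0]mulf_eq0 (negbTE b_neq0) orbF => r0 /eqP r1.
  rewrite r1 mul0r addr0 in r0; apply/polyP => i; rewrite coef0.
  case: i => [|[|i]]; [exact/eqP | by [] |].
  by rewrite nth_default // (leq_trans szr).
have [||//] := factor _ _ dvd_q mon_q; rewrite ?szq //.
rewrite rmorphD rmorphXn rmorphB /= horner_algX !horner_algC => /eqP.
by rewrite addr_eq0 => /eqP E; right; exists a, b.
Qed.

(** * Homogeneous elements of a simple algebra *)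

Section Simple.
Variables (K : fieldType) (A : vectType K) (mul : {bilinear A -> A -> A}).
Hypotheses (mulA : associative mul) (simpleA : is_simple mul).

(** The condition on [x] makes [x A] a two-sided ideal. If it were zero, the
    line spanned by [x] would be an ideal with zero product, hence all of [A],
    and the product of [A] would vanish. *)
Lemma normal_mul_surjective x : x != 0 ->
    (forall y, exists z, mul y x = mul x z) ->
  forall y, exists z, mul x z = y.
Proof.
move=> x_neq0 normal_x; have [[a [b ab_neq0]] ideals] := simpleA.
pose I := limg (linfun (mul x)).
have memI z : mul x z \in I.
  by rewrite -[mul x z](lfunE (mul x)) memv_img ?memvf.
have idealI : two_sided_ideal mul I.
  move=> y _ /memv_imgP[u _ ->]; rewrite lfunE /=.
  have [z Ez] := normal_x y; split; last by rewrite -mulA.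
  by rewrite mulA Ez -mulA.
have [I0|IT] := ideals I idealI; last first.
  move=> y; have : y \in I by rewrite IT memvf.
  by move=> /memv_imgP[z _ ->]; exists z; rewrite lfunE.
have xz0 z : mul x z = 0 by apply/eqP; rewrite -memv0 -I0.
have zx0 z : mul z x = 0 by have [y ->] := normal_x z; apply: xz0.
have [||line] := ideals <[x]>%VS.
- move=> y _ /vlineP[c ->]; rewrite linearZr_LR linearZl_LR /= xz0 zx0.
  by rewrite scaler0 mem0v.
- by move=> line0; have := memv_line x; rewrite line0 memv0 (negbTE x_neq0).
case: ab_neq0; have : a \in <[x]>%VS by rewrite line memvf.
by move=> /vlineP[c ->]; rewrite linearZl_LR /= xz0 scaler0.
Qed.

Lemma surjective_linear_regular (f : {linear A -> A}) :
  (forall y, exists z, f z = y) -> forall z, f z = 0 -> z = 0.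
Proof.
move=> surj z fz; have limg_f : limg (linfun f) = fullv.
  apply/eqP; rewrite eqEsubv subvf /=; apply/subvP => y _.
  by have [u <-] := surj y; rewrite -[f u](lfunE f) memv_img ?memvf.
have := limg_ker_dim (linfun f) fullv; rewrite limg_f capfv => /eqP.
rewrite -[X in _ == X]add0n eqn_add2r dimv_eq0 => /lker0P inj.
by apply: inj; rewrite !lfunE /= fz linear0.
Qed.

Lemma central_mul_regular x y : (forall u, mul x u = mul u x) ->
  mul x y = 0 -> x = 0 \/ y = 0.
Proof.
move=> xC xy0; have [->|x_neq0] := eqVneq x 0; [by left | right].
apply: (surjective_linear_regular (f := mul x)) xy0.
by apply: normal_mul_surjective => // u; exists u; rewrite xC.
Qed.

Variables (Gamma : zmodType) (pairing : Gamma -> Gamma -> 'Z_2).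
Variable deg : Gamma -> {vspace A}.
Hypothesis gradedA : graded_commutative mul pairing deg.

Definition homogeneous x := exists g, x \in deg g.

Lemma homogeneous_span x :
  exists2 l : seq A, {in l, forall h, homogeneous h} & x = \sum_(h <- l) h.
Proof.
have [[[span _] _] _] := gradedA; have [r] := span x.
elim: r x => [|g r IHr] x.
  by rewrite big_nil memv0 => /eqP->; exists [::]; rewrite ?big_nil.
rewrite big_cons => /memv_addP[u ug [v /IHr[l lh ->] ->]].
exists (u :: l); last by rewrite big_cons.
by move=> h; rewrite inE => /predU1P[->|/lh //]; exists g.
Qed.

Lemma homogeneous_sign x y : homogeneous x -> homogeneous y ->
  exists b : bool, mul x y = (-1) ^+ b *: mul y x.
Proof.
move=> [g xg] [h yh]; exists (odd (pairing g h)).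
by rewrite signr_odd; have [_] := gradedA; apply.
Qed.

(** Only a sign appears when [x] is moved across each homogeneous component. *)
Lemma homogeneous_normal x : homogeneous x ->
  (forall y, exists z, mul y x = mul x z) /\
  (forall y, exists z, mul x y = mul z x).
Proof.
move=> hx; split=> y; have [l lh ->] := homogeneous_span y.
  elim: l lh => [|h l IHl] lh.
    by exists 0; rewrite big_nil linear0l linear0r.
  have [z Ez] : exists z, mul (\sum_(i <- l) i) x = mul x z.
    by apply: IHl => k kl; apply: lh; rewrite inE kl orbT.
  have [b Eb] := homogeneous_sign (lh h (mem_head _ _)) hx.
  exists ((-1) ^+ b *: h + z).
  by rewrite big_cons linearDl linearDr /= Ez Eb linearZr_LR.
elim: l lh => [|h l IHl] lh.
  by exists 0; rewrite big_nil linear0l linear0r.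
have [z Ez] : exists z, mul x (\sum_(i <- l) i) = mul z x.
  by apply: IHl => k kl; apply: lh; rewrite inE kl orbT.
have [b Eb] := homogeneous_sign hx (lh h (mem_head _ _)).
exists ((-1) ^+ b *: h + z).
by rewrite big_cons linearDl linearDr /= Ez Eb linearZl_LR.
Qed.

Lemma homogeneous_surjective x : homogeneous x -> x != 0 ->
  (forall y, exists z, mul x z = y) /\ (forall y, exists z, mul z x = y).
Proof.
move=> hx x_neq0; have [nl nr] := homogeneous_normal hx.
have surj := normal_mul_surjective x_neq0 nl; split=> // y.
by have [z <-] := surj y; have [u ->] := nr z; exists u.
Qed.

Lemma homogeneous_regular x y : homogeneous x -> x != 0 -> mul x y = 0 -> y = 0.
Proof.
move=> hx x_neq0; have [surj _] := homogeneous_surjective hx x_neq0.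
exact: (surjective_linear_regular (f := mul x)).
Qed.

(** For a nonzero homogeneous [x] solve [x e = x] and [f x = x]. Since [x] can
    be cancelled on both sides, [e] is a left unit and [f] a right unit. *)
Lemma simple_unit : exists one : A,
  [/\ left_id one mul, right_id one mul & one != 0].
Proof.
have [[a [b ab_neq0]] _] := simpleA.
have [x hx x_neq0] : exists2 x, homogeneous x & x != 0.
  apply: contrapT => no; case: ab_neq0; have [l lh ->] := homogeneous_span a.
  suff -> : \sum_(h <- l) h = 0 by rewrite linear0l.
  rewrite big_seq big1 // => h /lh hh; apply/eqP; apply: contra_notT no => h0.
  by exists h.
have [surjl surjr] := homogeneous_surjective hx x_neq0.
have [e Ee] := surjl x; have [f Ef] := surjr x.
have e1 : left_id e mul.
  move=> y; apply/subr0_eq; apply: (homogeneous_regular hx x_neq0).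
  by rewrite linearBr /= mulA Ee subrr.
have f1 : right_id f mul.
  move=> y; apply/subr0_eq.
  apply: (surjective_linear_regular (f := applyr mul x)) => //=.
  by rewrite linearBl /= -mulA Ef subrr.
have ef : e = f by rewrite -[LHS]f1 e1.
exists e; split=> //; first by rewrite ef.
by apply: contraNneq x_neq0 => e0; rewrite -Ee e0 linear0r.
Qed.

End Simple.

(** The proofs are parameters of the carrier so that the instances of algebra
    structures on it can find them. *)
Definition with_unit (K : fieldType) (A : vectType K)
  (mul : {bilinear A -> A -> A}) (mulA : associative mul) (one : A)
  (mul1l : left_id one mul) (mul1r : right_id one mul) (one_neq0 : one != 0) :
  Type := A.

Section WithUnit.
Variables (K : fieldType) (A : vectType K) (mul : {bilinear A -> A -> A}).
Hypothesis mulA : associative mul.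
Variable one : A.
Hypotheses (mul1l : left_id one mul) (mul1r : right_id one mul).
Hypothesis one_neq0 : one != 0.
Local Notation U := (with_unit mulA mul1l mul1r one_neq0).

HB.instance Definition _ := Vector.copy U A.

Lemma with_unit_mulDl : left_distributive (mul : U -> U -> U) +%R.
Proof. by move=> x y z; apply: linearDl. Qed.

Lemma with_unit_mulDr : right_distributive (mul : U -> U -> U) +%R.
Proof. by move=> x y z; apply: linearDr. Qed.

HB.instance Definition _ := GRing.Zmodule_isNzRing.Build U
  mulA mul1l mul1r with_unit_mulDl with_unit_mulDr one_neq0.

Lemma with_unit_scaleAl (c : K) (x y : U) : c *: (x * y) = c *: x * y.
Proof. exact/esym/(linearZl_LR mul). Qed.

Lemma with_unit_scaleAr (c : K) (x y : U) : c *: (x * y) = x * (c *: y).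
Proof. exact/esym/(linearZr_LR mul). Qed.

HB.instance Definition _ := GRing.Lmodule_isLalgebra.Build K U
  with_unit_scaleAl.
HB.instance Definition _ := GRing.Lalgebra_isAlgebra.Build K U
  with_unit_scaleAr.
HB.instance Definition _ := Algebra_isFalgebra.Build K U.

End WithUnit.

(** * Identification with Clifford algebras *)

Lemma sign_commutative_iso (F : fieldType) (A : algType F) (H : A -> Prop)
    (B : nat -> nat -> algType F) (g : forall p q, 'I_(p + q) -> B p q) :
    (2 : F) != 0 ->
    (forall c : F, c != 0 -> exists d (b : bool), d ^+ 2 * c = (-1) ^+ b) ->
    sign_commutative H -> central_scalars A ->
    (forall p q, clifford_system (fun i : 'I_(p + q) => p <= i)%N (@g p q)
       (enum 'I_(p + q))) ->
    (forall p q (x : B p q), in_span (@g p q) (enum 'I_(p + q)) x) ->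
  exists p q (f : {linear A -> B p q}), bijective f /\ {morph f : x y / x * y}.
Proof.
move=> F2 sqrtF scH center sysB spanB.
have [s [t [sys even_t spanA]]] := exists_spanning_system F2 sqrtF scH center.
have [p [q [e [sysA sz spane]]]] := clifford_system_enum sys spanA.
exists p, q; apply: clifford_system_iso F2 _ sysA (sysB p q) spane (spanB p q).
by rewrite size_enum_ord sz.
Qed.

Section ComplexStructureSign.
Variables (R : rcfType) (A : algType R) (j : A).
Hypotheses (jC : forall x, j * x = x * j) (j2 : j ^+ 2 = -1).
Local Notation AC := (complex_structure jC j2).

Lemma complex_structure_real (c : R) (x : AC) :
  (c%:C%C *: x : AC) = (c *: (x : A)) :> A.
Proof. by rewrite cstruct_scaleE /= scale0r addr0. Qed.

(** [H] itself is only stable under real scalars, so its complex multiples are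
    taken. They still span and commute up to sign since complex scalars are
    central, and the bound is a statement about rings. *)
Lemma sign_commutative_complex (H : A -> Prop) : sign_commutative H ->
  sign_commutative
    (fun x : AC => exists (c : R[i]) (h : AC), [/\ c != 0, H h & x = c *: h]).
Proof.
move=> scH; have [N bound] := sc_bound scH; split.
- move=> [c [h [c_neq0 Hh /esym/eqP]]].
  rewrite scaler_eq0 (negbTE c_neq0) => /eqP h0.
  by apply: (sc_nz scH); rewrite -[0]h0.
- move=> _ _ [c [h [c0 Hh ->]]] [d [k [d0 Hk ->]]].
  exists (c * d), (h * k : AC); split.
  + exact: mulf_neq0.
  + exact: (sc_mul scH).
  by rewrite -scalerAl -scalerAr scalerA.
- move=> d _ d0 [c [h [c0 Hh ->]]].
  by exists (d * c), h; rewrite scalerA; split=> //; apply: mulf_neq0.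
- move=> _ _ [c [h [c0 Hh ->]]] [d [k [d0 Hk ->]]].
  rewrite -!scalerAl -!scalerAr !scalerA [d * c]mulrC.
  have [E|E] := sc_comm scH Hh Hk; first by left; rewrite [h * k]E.
  by right; rewrite [h * k]E scalerN.
- move=> x; have [l lH Ex] := sc_span scH x; exists l => // h /lH Hh.
  by exists 1, h; rewrite scale1r oner_neq0.
- by exists N => s t sys; apply: (bound s).
Qed.

Lemma complex_structure_center :
    (forall z : A, (forall u, z * u = u * z) ->
       exists a b : R, z = a%:A + b *: j) ->
  central_scalars AC.
Proof.
move=> center z zC; have [a [b ->]] := center z zC.
exists (a +i* b)%C.
by rewrite -[RHS]/(a *: (1 : A) + b *: (j * 1)) mulr1.
Qed.

End ComplexStructureSign.

(** If [z] is central and not scalar, some [(z - a) / b] is a square root [j]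
    of [-1]. For another central [y] that is not scalar, [(y - c) ^ 2 = (d j) ^
    2] for some [c] and [d], and a difference of squares factors. *)
Lemma central_scalars_or_complex (R : rcfType) (A : falgType R) :
    central_regular A ->
  central_scalars A \/
  exists j : A, [/\ forall x, j * x = x * j, j ^+ 2 = -1
    & forall z, (forall u, z * u = u * z) -> exists a b : R, z = a%:A + b *: j].
Proof.
move=> reg; have [|/existsNP[z /not_implyP[zC z_ns]]] :=
  pselect (central_scalars A); first by left.
right; have scC (c : R) (u : A) : c%:A * u = u * c%:A.
  by rewrite -scalerAl -scalerAr mul1r mulr1.
have [//|[a [b [b_neq0 sq_z]]]] := central_quadratic_real reg zC.
pose j := b^-1 *: (z - a%:A).
have jC u : j * u = u * j.
  by rewrite -scalerAl -scalerAr mulrBl mulrBr zC scC.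
have j2 : j ^+ 2 = -1.
  by rewrite exprZn sq_z scalerN scalerA -exprMn mulVf // expr1n scale1r.
exists j; split=> // y yC.
have [[c ->]|[c [d [_ sq_y]]]] := central_quadratic_real reg yC.
  by exists c, 0; rewrite scale0r addr0.
pose v := y - c%:A.
have vC u : v * u = u * v by rewrite mulrBl mulrBr yC scC.
have djC u : d *: j * u = u * (d *: j) by rewrite -scalerAl -scalerAr jC.
have Ey : y = v + c%:A by rewrite subrK.
rewrite -/v in sq_y; clearbody v.
have : (v - d *: j) * (v + d *: j) = 0.
  rewrite mulrDr !mulrBl -[d *: j * v]vC addrA subrK -!expr2 sq_y exprZn j2.
  by rewrite scalerN opprK addNr.
case/reg=> [u|/eqP|/eqP]; first by rewrite mulrBl mulrBr vC djC.
  by rewrite subr_eq0 => /eqP Ev; exists c, d; rewrite Ey Ev addrC.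
by rewrite addr_eq0 => /eqP Ev; exists c, (- d); rewrite Ey Ev scaleNr addrC.
Qed.

Lemma real_sqrt_sign (R : rcfType) (c : R) : c != 0 ->
  exists d (b : bool), d ^+ 2 * c = (-1) ^+ b.
Proof.
move=> c_neq0; exists (Num.sqrt `|c|)^-1, (c < 0).
rewrite exprVn sqr_sqrtr // {2}[c]realEsign ?num_real // mulrCA mulVf ?mulr1 //.
by rewrite normr_eq0.
Qed.

Lemma complex_sqrt_sign (R : rcfType) (c : R[i]) : c != 0 ->
  exists d (b : bool), d ^+ 2 * c = (-1) ^+ b.
Proof.
move=> c_neq0; exists (sqrtc c)^-1, false.
by rewrite exprVn sqr_sqrtc mulVf.
Qed.

Lemma alg_isomorphic_intro (K L : fieldType) (s : {rmorphism K -> L})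
    (A : vectType K) (mul : {bilinear A -> A -> A}) (B : algType L)
    (f : A -> B) :
    (forall c x y, f (c *: x + y) = s c *: f x + f y) ->
    bijective f -> {morph f : x y / mul x y >-> x * y} ->
  alg_isomorphic s mul B.
Proof.
move=> fP bij_f fM.
pose fL := GRing.isLinear.Build K A B (s \; *:%R) f fP.
by exists (HB.pack_for {linear A -> B | s \; *:%R} f fL).
Qed.

Section Homogeneous.
Variables (K : fieldType) (A : vectType K) (mul : {bilinear A -> A -> A}).
Hypotheses (mulA : associative mul) (simpleA : is_simple mul).
Variable one : A.
Hypotheses (mul1l : left_id one mul) (mul1r : right_id one mul).
Hypothesis one_neq0 : one != 0.
Variables (Gamma : zmodType) (pairing : Gamma -> Gamma -> 'Z_2).
Variable deg : Gamma -> {vspace A}.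
Hypothesis gradedA : graded_commutative mul pairing deg.
Local Notation U := (with_unit mulA mul1l mul1r one_neq0).

Lemma with_unit_central_regular : central_regular U.
Proof. by move=> x y; apply: (central_mul_regular mulA simpleA). Qed.

Lemma homogeneous_sign_commutative : (2 : K) != 0 ->
  sign_commutative (fun x : U => homogeneous deg x /\ x != 0).
Proof.
move=> K2; split.
- by case; rewrite eqxx.
- move=> x y [hx x0] [hy y0]; split.
    have [[_ degM] _] := gradedA; case: hx hy => [g xg] [h yh].
    by exists (g + h); apply: degM.
  apply: contraNneq y0 => xy0; apply/eqP.
  exact: (homogeneous_regular mulA simpleA gradedA hx x0 xy0).
- move=> c x c0 [[g xg] x0]; split; last by rewrite scaler_eq0 negb_or c0.
  by exists g; apply: memvZ.
- move=> x y [hx _] [hy _]; have [b Eb] := homogeneous_sign gradedA hx hy.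
  have E : x * y = (-1) ^+ b *: (y * x) by exact: Eb.
  by rewrite E; case: (b); [right; rewrite scaleN1r | left; rewrite scale1r].
- move=> x; have [l lh Ex] := homogeneous_span gradedA x.
  exists (filter (predC1 0) l : seq U).
    by move=> h; rewrite mem_filter => /andP[h0 /lh hh].
  rewrite big_filter Ex [LHS](bigID (pred1 0)) /= big1 ?add0r // => h /eqP-> //.
- by exists (\dim {:U}) => s t; apply: clifford_system_bound.
Qed.

End Homogeneous.

Theorem theorem1 (R : realType) (Gamma : zmodType)
    (pairing : Gamma -> Gamma -> 'Z_2) (pairingP : biadditive pairing) :
  (forall (A : vectType R[i]) (mul : {bilinear A -> A -> A})
          (deg : Gamma -> {vspace A}),
     associative mul -> graded_commutative mul pairing deg -> is_simple mul ->
     exists p q : nat,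
       alg_isomorphic (K := R[i]) (L := R[i]) idfun mul (complex_clifford R p q))
  /\
  (forall (A : vectType R) (mul : {bilinear A -> A -> A})
          (deg : Gamma -> {vspace A}),
     associative mul -> graded_commutative mul pairing deg -> is_simple mul ->
     (exists p q : nat,
        alg_isomorphic (K := R) (L := R) idfun mul (clifford R p q)) \/
     (exists p q : nat,
        alg_isomorphic (real_complex R) mul (complex_clifford R p q))).
Proof.
have C2 : (2 : R[i]) != 0 by rewrite pnatr_eq0.
have R2 : (2 : R) != 0 by rewrite pnatr_eq0.
have sys p q := cplx_gen_system (@clifford_gen_system R p q).
have span p q := cplx_gen_span (@clifford_gen_span R p q).
split=> A mul deg mulA gradedA simpleA;
  have [one [mul1l mul1r one_neq0]] := simple_unit mulA simpleA gradedA;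
  pose U := with_unit mulA mul1l mul1r one_neq0;
  have reg : central_regular U by exact: with_unit_central_regular.
- have scU := homogeneous_sign_commutative mulA simpleA mul1l mul1r one_neq0
    gradedA C2.
  have center : central_scalars U by move=> z; apply: central_scalar_closed.
  have [p [q [f [bij_f fM]]]] := sign_commutative_iso
    (B := complex_clifford R) C2 (@complex_sqrt_sign R) scU center sys span.
  exists p, q; apply: (alg_isomorphic_intro (f := f)) => // c x y.
  exact: (linearP f).
have scU := homogeneous_sign_commutative mulA simpleA mul1l mul1r one_neq0
  gradedA R2.
have [center|[j [jC j2 center]]] := central_scalars_or_complex reg.
  left; have [p [q [f [bij_f fM]]]] := sign_commutative_iso (B := clifford R)
    R2 (@real_sqrt_sign R) scU center
    (@clifford_gen_system R) (@clifford_gen_span R).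
  exists p, q; apply: (alg_isomorphic_intro (f := f)) => // c x y.
  exact: (linearP f).
(* The centre is [R + R j]: the complex structure given by [j] has scalar
   centre. *)
right; have [p [q [f [bij_f fM]]]] := sign_commutative_iso
  (B := complex_clifford R) C2 (@complex_sqrt_sign R)
  (sign_commutative_complex jC j2 scU) (complex_structure_center center)
  sys span.
exists p, q; apply: (alg_isomorphic_intro (f := f)) => // c x y.
have -> : c *: x + y = c%:C%C *: (x : complex_structure jC j2) + y.
  by rewrite complex_structure_real.
exact: (linearP f).
Qed.
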